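(* Let $\alpha>0$ and $\Delta\in\mathbb{N}$ be constants and let $p=p(n)$. Suppose that for each $n$, $G_\alpha$ and $F$ are $n$-vertex graphs such that (i) $V(G_\alpha)=[n]$ and $G_\alpha$ has minimum degree at least $\alpha n$, and (ii) $F$ has maximum degree $\Delta$ and $F$ has an $(\alpha,p)$-suitable set of subgraphs $\mathcal{F}$. Then with high probability $G_\alpha\cup G(n,p)$ contains a copy of $F$.
   Context: All graphs are indexed by $n$ and asymptotic statements refer to $n\to\infty$; ''with high probability'' (whp) means with probability $1-o(1)$. $G(m,q)$ is the binomial random graph on vertex set $[m]=\{1,\dots,m\}$ with each pair an edge independently with probability $q$; unions of graphs on the same vertex set take the union of edge sets. Definition ($(\alpha,p)$-suitable): let $F$ be an $n$-vertex graph with maximum degree $\Delta$ and put $\varepsilon=\big(\frac{\alpha}{4\Delta}\big)^{2\Delta}$. A set $\mathcal{F}$ of induced subgraphs of $F$ is $(\alpha,p)$-suitable if every graph in $\mathcal{F}$ has at least $(1-\varepsilon)n$ vertices and: (A1) with probability $1-o(1)$ there exists $F^*\in\mathcal{F}$ such that $G(n,p/2)$ contains a copy of $F^*$; (A2) whenever $F^*\in\mathcal{F}$, $G$ is a graph on vertex set $[2n]$ containing a copy $\hat F$ of $F^*$, and for each $v\in V(F)\setminus V(F^* )$ a set $B(v)\subseteq[2n]\setminus V(\hat F)$ is given with $|B(v)\cap N_G(w)|\ge 4\varepsilon n$ for every $w\in[2n]$, then whp $\hat F$ can be extended to a copy of $F$ in $G\cup G(2n,p/6)$ in which every vertex $v\in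 V(F)\setminus V(F^* )$ is mapped to a vertex of $B(v)$. *)

(* Defs.v *)
From HB Require Import structures.
From mathcomp Require Import all_boot all_order all_algebra.
From mathcomp Require Import all_classical all_reals all_analysis.
Set Implicit Arguments.
Unset Strict Implicit.
Unset Printing Implicit Defensive.
Import Order.TTheory GRing.Theory Num.Theory.
Import numFieldNormedType.Exports.
Local Open Scope ring_scope.

Record sgraph (T : finType) := SGraph {
  edges : {set {set T}};
  edges_card2 : [forall e in edges, #|e| == 2%N] }.

HB.instance Definition _ (T : finType) := [isSub for @edges T].
HB.instance Definition _ (T : finType) := [Finite of sgraph T by <:].

Section Graphs.
Variable T : finType.
Implicit Types (F G H : sgraph T) (S : {set T}).

Definition adj G (u v : T) : bool := [set u; v]%SET \in edges G.

Definition nbhd G (v : T) : {set T} := [set w | adj G v w]%SET.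

Definition max_degree G : nat := \max_(v : T) #|nbhd G v|.

Lemma graph_union_subproof G H :
  [forall e in (edges G :|: edges H)%SET, #|e| == 2%N].
Proof.
apply/forall_inP => e; rewrite inE => /orP[he|he].
  exact: (forall_inP (edges_card2 G) _ he).
exact: (forall_inP (edges_card2 H) _ he).
Qed.

Definition graph_union G H : sgraph T := SGraph (graph_union_subproof G H).

Lemma induced_subproof F S :
  [forall e in [set e : {set {x : T | x \in S}} | (val @: e)%SET \in edges F]%SET,
     #|e| == 2%N].
Proof.
apply/forall_inP => e; rewrite inE => he.
rewrite -(card_imset _ val_inj).
exact: (forall_inP (edges_card2 F) _ he).
Qed.

(* [F[S]], on the subtype of vertices lying in [S]. *)
Definition induced_subgraph F S : sgraph {x : T | x \in S} :=
  SGraph (induced_subproof F S).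

End Graphs.

(* A copy of [F] in [G] is an injective map of vertices preserving edges; it
   need not be induced. *)
Definition is_copy (T U : finType) (F : sgraph T) (G : sgraph U)
    (f : {ffun T -> U}) : bool :=
  injectiveb f && [forall x, forall y, adj F x y ==> adj G (f x) (f y)].

Definition contains_copy (T U : finType) (F : sgraph T) (G : sgraph U) : bool :=
  [exists f : {ffun T -> U}, is_copy F G f].

Definition gnp_prob (R : realType) (m : nat) (q : R) (E : pred (sgraph 'I_m)) : R :=
  \sum_(g : sgraph 'I_m | E g)
     q ^+ #|edges g| * (1 - q) ^+ ('C(m, 2) - #|edges g|)%N.

(* [P n] is the probability of the [n]-th event. *)
Definition whp (R : realType) (P : nat -> R) : Prop := (P @ \oo --> (1 : R))%classic.

Definition min_degree_ge (R : realType) (T : finType) (G : sgraph T) (d : R) : Prop :=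
  forall v : T, d <= #|nbhd G v|%:R.

Definition suitable_eps (R : realType) (alpha : R) (Delta : nat) : R :=
  (alpha / (4 * Delta%:R)) ^+ (2 * Delta)%N.

(* The copy [Fhat] of [F[S]] extends to a copy of [F] in [G] sending every
   vertex [v] outside [S] into [B v]. *)
Definition extends_to_copy (T U : finType) (F : sgraph T) (S : {set T})
    (Fhat : {ffun {x : T | x \in S} -> U}) (B : T -> {set U}) (G : sgraph U) : bool :=
  [exists f : {ffun T -> U},
     [&& is_copy F G f,
         [forall x : {x : T | x \in S}, f (val x) == Fhat x]
       & [forall v : T, (v \notin S) ==> (f v \in B v)]]].

(* The family of induced subgraphs is given by the family [FF n] of their
   vertex sets.  In the last clause the probability tends to 1 uniformly over
   all the data, which is the same as requiring it for every choice of data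
   depending on [n]. *)
Definition suitable (R : realType) (alpha : R) (Delta : nat) (p : nat -> R)
    (V : nat -> finType) (F : forall n, sgraph (V n))
    (FF : forall n, {set {set V n}}) : Prop :=
  let eps := suitable_eps alpha Delta in
  [/\ \forall n \near \oo%classic, forall S, S \in FF n ->
        (1 - eps) * n%:R <= #|S|%:R,
      whp (fun n => gnp_prob (p n / 2)
        [pred g : sgraph 'I_n |
           [exists S in FF n, contains_copy (induced_subgraph (F n) S) g]])
    & forall eta : R, 0 < eta -> \forall n \near \oo%classic,
        forall (S : {set V n}) (G : sgraph 'I_(2 * n))
               (Fhat : {ffun {x : V n | x \in S} -> 'I_(2 * n)})
               (B : V n -> {set 'I_(2 * n)}),
          S \in FF n ->
          is_copy (induced_subgraph (F n) S) G Fhat ->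
          (forall v, v \notin S ->
             (B v \subset ~: [set Fhat x | x : {x : V n | x \in S}])%SET /\
             forall w : 'I_(2 * n), 4 * eps * n%:R <= #|(B v :&: nbhd G w)%SET|%:R) ->
          1 - eta <= gnp_prob (p n / 6)
            [pred g : sgraph 'I_(2 * n) | extends_to_copy (F n) Fhat B (graph_union G g)]].

(* Main.v *)
(* Reveal [G(n, p)] as [G(n, p/2)] together with the projection to [[n]] of
   [G(2n, p/6)], where each vertex of [[n]] has two clones and pairs of lower
   clones are ignored: every pair of [[n]] has three preimages, and
   1 - (1 - p/2) (1 - p/6)^3 <= p.

   The first graph contains a copy of some F[S] with S in FF, whose position in
   [[n]] may be taken uniformly random.  Extend the copy to a bijection [phi]
   from V(F) to [[n]], which reserves a point [phi v] for each v outside S, and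
   fix a set I of vertices of S whose closed neighbourhoods lie in S and are
   pairwise disjoint, of size of order n / Delta^2.  A vertex x of I can be
   moved from [phi x] to [phi v] whenever the images of its neighbours are
   adjacent to [phi v] in [Galpha].  By an exponential moment bound for uniform
   permutations, with high probability for all points u, w of [[n]] at least
   4 eps n vertices of I can be moved to u and are placed at a neighbour of w.
   Hence (A2) applies with B(v) the upper clones of the places which can be
   vacated in favour of v; exchanging each v outside S with the vertex whose
   place it takes turns the resulting copy of F into one in [[n]]. *)
Require Import Defs.
From HB Require Import structures.
From mathcomp Require Import all_boot all_order all_fingroup all_algebra.
From mathcomp Require Import all_classical all_reals all_analysis.
From mathcomp Require Import ring lra.
Import boot.fintype boot.finset.
Set Implicit Arguments.
Unset Strict Implicit.
Unset Printing Implicit Defensive.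
Import Order.TTheory GRing.Theory Num.Theory.
Import numFieldNormedType.Exports.
Local Open Scope ring_scope.

(** * Binomial random subsets and random graphs *)

Section BernoulliSubset.
Variables (R : realType) (T : finType).
Implicit Types (pr : T -> R) (f : {set T} -> R).

Definition subset_weight pr (A : {set T}) : R :=
  \prod_x (if x \in A then pr x else 1 - pr x).

Definition subset_mean pr f : R := \sum_(A : {set T}) subset_weight pr A * f A.

(** The expectation with the elements of [s] revealed one at a time and all others absent. This form
    allows induction on the ground set; [mean_along_enum] identifies it with [subset_mean]. *)
Fixpoint mean_along (s : seq T) pr f : R :=
  if s is x :: s' then
    pr x * mean_along s' pr (fun A => f (x |: A)%SET)
    + (1 - pr x) * mean_along s' pr f
  else f set0.

Lemma subset_mean_split pr x f :
  let rest A := \prod_(y | y != x) (if y \in A then pr y else 1 - pr y) in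
  subset_mean pr f =
    pr x * \sum_(A : {set T} | x \notin A) rest A * f (x |: A)%SET
    + (1 - pr x) * \sum_(A : {set T} | x \notin A) rest A * f A.
Proof.
rewrite /subset_mean /= (bigID (fun A : {set T} => x \in A)) /=; congr (_ + _).
  rewrite (reindex_onto (fun A => x |: A)%SET (fun A => A :\ x)%SET) /=; last first.
    by move=> A xA; rewrite setD1K.
  rewrite mulr_sumr; apply: eq_big => A.
    rewrite setU11 /=; apply/eqP/idP => [<-|xA]; first by rewrite !inE eqxx.
    by rewrite setU1K.
  rewrite setU11 /= => /eqP EA.
  have xA : x \notin A by rewrite -EA !inE eqxx.
  rewrite /subset_weight (bigD1 x) //= setU11 -mulrA; congr (_ * (_ * _)).
  by apply: eq_bigr => y yx; rewrite !inE (negbTE yx).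
rewrite mulr_sumr; apply: eq_bigr => A xA.
by rewrite /subset_weight (bigD1 x) //= (negbTE xA) -mulrA.
Qed.

(** Throwing in [x] once more, independently with probability [c], only changes the marginal at [x]:
    it stays absent with probability [(1 - pr x) * (1 - c)]. *)
Lemma subset_mean_update pr pr' x (c : R) f :
  (forall y, y != x -> pr' y = pr y) ->
  pr' x = 1 - (1 - pr x) * (1 - c) ->
  subset_mean pr' f =
    c * subset_mean pr (fun A => f (x |: A)%SET) + (1 - c) * subset_mean pr f.
Proof.
move=> pr'E pr'x; rewrite (subset_mean_split pr' x) !(subset_mean_split pr x).
have restE (A : {set T}) :
    \prod_(y | y != x) (if y \in A then pr' y else 1 - pr' y) =
    \prod_(y | y != x) (if y \in A then pr y else 1 - pr y).
  by apply: eq_bigr => y /pr'E ->.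
rewrite pr'x /=.
under eq_bigr => A _ do rewrite restE.
under [X in _ + _ * X = _]eq_bigr => A _ do rewrite restE.
under [X in _ = c * (_ * X + _) + _]eq_bigr => A _ do rewrite setUA setUid.
ring.
Qed.

Lemma mean_along_cst s pr : mean_along s pr (fun=> 1) = 1.
Proof. by elim: s => //= x s ->; ring. Qed.

Lemma ler_mean_along s pr pr' f f' :
  (forall x, 0 <= pr x) -> (forall x, pr x <= pr' x) -> (forall x, pr' x <= 1) ->
  (forall A B : {set T}, A \subset B -> f A <= f B) ->
  (forall A, f A <= f' A) ->
  mean_along s pr f <= mean_along s pr' f'.
Proof.
move=> pr0 prr pr1; elim: s f f' => [|x s IH] f f' fmono ff' /=; first exact: ff'.
have fxmono (A B : {set T}) : A \subset B -> f (x |: A)%SET <= f (x |: B)%SET.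
  by move=> AB; apply: fmono; apply: setUS.
have le1 := IH _ (fun A => f' (x |: A)%SET) fxmono (fun A => ff' _).
have le0 := IH _ _ fmono ff'.
(* Raising [pr x] to [pr' x] moves weight from the branch without [x] to the branch with [x], so
   these two branches must be compared as well. *)
have le10 : mean_along s pr f <= mean_along s pr' (fun A => f' (x |: A)%SET).
  by apply: IH => // A; apply: le_trans (ff' _); apply: fmono; apply: subsetUr.
have := pr0 x; have := prr x; have := pr1 x; nra.
Qed.

End BernoulliSubset.

Section SubsetImage.
Variables (R : realType) (T U : finType) (pi : U -> option T).

Definition pimage (B : {set U}) : {set T} :=
  [set e | [exists x in B, pi x == Some e]]%SET.

Lemma pimage0 : pimage set0 = set0.
Proof. by apply/setP => e; rewrite !inE; apply/existsP => -[x]; rewrite inE. Qed.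

Lemma pimageU1 x B : pimage (x |: B)%SET =
  if pi x is Some e then (e |: pimage B)%SET else pimage B.
Proof.
apply/setP => e'; rewrite inE.
apply/exists_inP/idP => [[y]|].
  rewrite !inE => /orP[/eqP->|yB] /eqP Ey; first by rewrite Ey setU11.
  have e'B : e' \in pimage B by rewrite inE; apply/exists_inP; exists y => //; rewrite Ey.
  by case: (pi x) => [e|] //; rewrite in_setU1 e'B orbT.
have inB : e' \in pimage B -> exists2 y, y \in (x |: B)%SET & pi y == Some e'.
  by rewrite inE => /exists_inP[y yB Ey]; exists y; rewrite // !inE yB orbT.
case E: (pi x) => [e|] //; rewrite inE => /orP[|//].
by rewrite inE => /eqP ->; exists x; rewrite ?setU11 // E.
Qed.

(** Each newly revealed [x] adds its image [pi x] with probability [pr' x], which is one application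
    of [subset_mean_update]; elements sent to [None] change nothing. *)
Lemma subset_mean_image_along (s : seq U) (pr : T -> R) (pr' : U -> R) f :
  subset_mean pr (fun A => mean_along s pr' (fun B => f (A :|: pimage B)%SET)) =
  subset_mean (fun e => 1 - (1 - pr e) * \prod_(x <- s | pi x == Some e) (1 - pr' x)) f.
Proof.
elim: s f => [|x s IH] f /=.
  congr (subset_mean _ _).
    by apply/funext => e; rewrite big_nil; ring.
  by apply/funext => A; rewrite pimage0 setU0.
rewrite [LHS](_ : _ =
  pr' x * subset_mean pr (fun A => mean_along s pr'
              (fun B => f (A :|: pimage (x |: B))%SET)) +
  (1 - pr' x) * subset_mean pr (fun A => mean_along s pr'
              (fun B => f (A :|: pimage B)%SET))); last first.
  rewrite /subset_mean !mulr_sumr -big_split /=; apply: eq_bigr => A _; ring.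
rewrite IH.
case E: (pi x) => [e|].
  pose f' C := f (e |: C)%SET.
  rewrite [X in pr' x * X](_ : _ = subset_mean pr (fun A => mean_along s pr'
              (fun B => f' (A :|: pimage B)%SET))); last first.
    congr subset_mean; apply/funext => A; congr mean_along; apply/funext => B.
    by rewrite pimageU1 E /f' setUCA.
  rewrite IH; apply/esym/(subset_mean_update (x := e)) => [y ye|].
    by rewrite big_cons E ifN //; apply/eqP => -[] /eqP; rewrite eq_sym (negbTE ye).
  by rewrite big_cons E eqxx; ring.
rewrite [X in pr' x * X](_ : _ = subset_mean pr (fun A => mean_along s pr'
              (fun B => f (A :|: pimage B)%SET))); last first.
  congr subset_mean; apply/funext => A; congr mean_along; apply/funext => B.
  by rewrite pimageU1 E.
rewrite IH -mulrDl [pr' x + _]addrC subrK mul1r; congr (subset_mean _ _).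
by apply/funext => e; rewrite big_cons E.
Qed.

End SubsetImage.

Lemma mean_along_enum (R : realType) (T : finType) (pr : T -> R) f :
  mean_along (enum T) pr f = subset_mean pr f.
Proof.
(* With [pr] replaced by 0 the first random set is almost surely empty, and only the image of the
   second remains. *)
have := @subset_mean_image_along R T T (@Some T) (enum T) (fun=> 0) pr f.
rewrite {1}/subset_mean (bigD1 set0) //= [X in _ + X]big1 ?addr0 => [|A A0]; last first.
  have /set0Pn[x xA] := A0.
  by rewrite /subset_weight (bigD1 x) //= xA !mul0r.
rewrite /subset_weight big1 ?mul1r => [|x _]; last by rewrite inE subr0.
have -> : (fun B => f (set0 :|: pimage Some B)%SET) = f.
  apply/funext => B; rewrite set0U; congr f; apply/setP => x; rewrite inE.
  apply/exists_inP/idP => [[y yB /eqP[<-]]//|xB]; by exists x.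
move->; congr (subset_mean _ _); apply/funext => e.
rewrite big_enum_cond /= (big_pred1 e) => [|x]; first by ring.
by apply/eqP/eqP => [[]|->].
Qed.

Lemma subset_mean_cst (R : realType) (T : finType) (pr : T -> R) :
  subset_mean pr (fun=> 1) = 1.
Proof. by rewrite -mean_along_enum mean_along_cst. Qed.

Lemma subset_mean_image (R : realType) (T U : finType) (pi : U -> option T)
    (pr : T -> R) (pr' : U -> R) f :
  subset_mean pr (fun A => subset_mean pr' (fun B => f (A :|: pimage pi B)%SET)) =
  subset_mean (fun e => 1 - (1 - pr e) * \prod_(x | pi x == Some e) (1 - pr' x)) f.
Proof.
transitivity (subset_mean pr (fun A => mean_along (enum U) pr'
    (fun B => f (A :|: pimage pi B)%SET))).
  by congr subset_mean; apply/funext => A; rewrite mean_along_enum.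
rewrite subset_mean_image_along; congr (subset_mean _ _); apply/funext => e.
by rewrite big_enum_cond.
Qed.

Lemma ler_subset_mean_prob (R : realType) (T : finType) (pr pr' : T -> R) f :
  (forall x, 0 <= pr x) -> (forall x, pr x <= pr' x) -> (forall x, pr' x <= 1) ->
  (forall A B : {set T}, A \subset B -> f A <= f B) ->
  subset_mean pr f <= subset_mean pr' f.
Proof. by move=> *; rewrite -!mean_along_enum; apply: ler_mean_along. Qed.

Lemma subset_weight_ge0 (R : realType) (T : finType) (pr : T -> R) A :
  (forall x, 0 <= pr x <= 1) -> 0 <= subset_weight pr A.
Proof.
move=> pr01; apply: prodr_ge0 => x _.
by have /andP[] := pr01 x; case: ifP; rewrite ?subr_ge0.
Qed.

Lemma ler_subset_mean (R : realType) (T : finType) (pr : T -> R) f f' :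
  (forall x, 0 <= pr x <= 1) -> (forall A, f A <= f' A) ->
  subset_mean pr f <= subset_mean pr f'.
Proof.
by move=> pr01 ff'; apply: ler_sum => A _; rewrite ler_wpM2l // subset_weight_ge0.
Qed.

Section EdgeSets.
Variable m : nat.

Lemma edges_of_subproof (A : {set {set 'I_m}}) :
  [forall e in [set e in A | #|e| == 2%N]%SET, #|e| == 2%N].
Proof. by apply/forall_inP => e; rewrite inE => /andP[]. Qed.

(** Sets that are not pairs are discarded, which makes this a total left inverse of [edges]. *)
Definition graph_of (A : {set {set 'I_m}}) : sgraph 'I_m :=
  SGraph (edges_of_subproof A).

Lemma graph_of_edges (g : sgraph 'I_m) : graph_of (edges g) = g.
Proof.
apply/val_inj/setP => e; rewrite inE; case: (boolP (e \in _)) => //= eg.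
exact: (forall_inP (edges_card2 g)).
Qed.

(* [G(m, q)] as a random set of sets in which all sets of cardinality other
   than two have probability zero. *)
Definition pair_prob (R : realType) (q : R) (e : {set 'I_m}) : R :=
  if #|e| == 2%N then q else 0.

Lemma pair_prob01 (R : realType) (q : R) e : 0 <= q <= 1 -> 0 <= pair_prob q e <= 1.
Proof. by rewrite /pair_prob; case: ifP; rewrite ?lexx ?ler01. Qed.

(** Families containing a set that is not a pair have weight 0. The others are edge sets of graphs,
    and there the absent sets that are not pairs contribute factors 1. *)
Lemma gnp_probE (R : realType) (q : R) (P : pred (sgraph 'I_m)) :
  gnp_prob q P = subset_mean (pair_prob q) (fun A => (P (graph_of A))%:R).
Proof.
rewrite /subset_mean.
rewrite (bigID (fun A : {set {set 'I_m}} => [forall e in A, #|e| == 2%N])) /=.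
rewrite [X in _ + X]big1 ?addr0; last first.
  move=> A /forall_inPn[e eA e2]; rewrite /subset_weight (bigD1 e) //= eA.
  by rewrite /pair_prob (negbTE e2) !mul0r.
rewrite (reindex_onto (@edges _) graph_of) /=; last first.
  move=> A /forall_inP A2; apply/setP => e; rewrite inE.
  by case: (boolP (e \in A)) => //= /A2.
rewrite /gnp_prob big_mkcond /=; apply: eq_big => [g|g _].
  by rewrite edges_card2 graph_of_edges eqxx.
rewrite graph_of_edges.
case: (P g); last by rewrite mulr0.
rewrite mulr1 /subset_weight (bigID (fun e : {set 'I_m} => #|e| == 2%N)) /=.
rewrite [X in _ = _ * X]big1 ?mulr1; last first.
  move=> e e2; rewrite ifN /pair_prob ?(negbTE e2) ?subr0 //.
  by apply: contra e2 => /(forall_inP (edges_card2 g)).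
rewrite (bigID (fun e => e \in edges g)) /=; congr (_ * _).
  rewrite (eq_big (fun e => e \in edges g) (fun=> q)) => [|e|e]; first by rewrite prodr_const.
    by case: (boolP (e \in edges g)); rewrite ?andbF // => /(forall_inP (edges_card2 g)) ->.
  by rewrite /pair_prob => /andP[-> ->].
rewrite (eq_big (fun e => e \in [set e : {set 'I_m} | #|e| == 2%N]%SET :\: edges g)
           (fun=> 1 - q)) => [|e|e]; last first.
- by rewrite /pair_prob => /andP[-> /negbTE->].
- by rewrite !inE andbC.
rewrite prodr_const cardsD card_draws card_ord; congr (_ ^+ (_ - _)).
apply: eq_card => e; rewrite !inE.
by case: (boolP (e \in edges g)); rewrite ?andbF // => /(forall_inP (edges_card2 g)) ->.
Qed.

Lemma gnp_probT (R : realType) (q : R) : @gnp_prob R m q predT = 1.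
Proof. by rewrite gnp_probE /= subset_mean_cst. Qed.

Lemma gnp_weight_ge0 (R : realType) (q : R) (g : sgraph 'I_m) : 0 <= q <= 1 ->
  0 <= q ^+ #|edges g| * (1 - q) ^+ ('C(m, 2) - #|edges g|)%N.
Proof. by move=> /andP[q0 q1]; rewrite mulr_ge0 // exprn_ge0 // subr_ge0. Qed.

Lemma ler_gnp_prob (R : realType) (q : R) (P Q : pred (sgraph 'I_m)) : 0 <= q <= 1 ->
  (forall g, P g -> Q g) -> gnp_prob q P <= gnp_prob q Q.
Proof.
move=> q01 PQ; rewrite /gnp_prob big_mkcond [leRHS]big_mkcond /=.
apply: ler_sum => g _; case: ifP => [/PQ ->//|_].
by case: ifP => // _; apply: gnp_weight_ge0.
Qed.

Lemma gnp_prob_le1 (R : realType) (q : R) (P : pred (sgraph 'I_m)) : 0 <= q <= 1 ->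
  gnp_prob q P <= 1.
Proof. by move=> q01; rewrite -(gnp_probT q); apply: ler_gnp_prob. Qed.

End EdgeSets.

(** * Exponential moments over uniform permutations *)

Section UniformPermutation.
Variables (R : realType) (U : finType).
Implicit Types (Y A : {set U}) (h : {perm U} -> R) (s : {perm U}).
Implicit Types (c : U * {set U}) (b : seq (U * {set U})) (bs : seq (seq (U * {set U}))).

Definition depends_on Y h := forall s t : {perm U}, (forall x, x \in Y -> s x = t x) -> h s = h t.

(* Precomposing with a transposition of two points outside [Y] does not change
   [h], so all points outside [Y] contribute the same as [y]; together they
   contribute at least [#|A| - #|Y|] to each summand. *)
Lemma sum_perm_next Y h y A :
  y \notin Y -> (forall s, 0 <= h s) -> depends_on Y h ->
  (#|A|%:R - #|Y|%:R) * \sum_s h s <= #|U|%:R * \sum_s h s * (s y \in A)%:R.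
Proof.
move=> yY h0 hY.
have swap z : z \notin Y ->
    \sum_s h s * (s z \in A)%:R = \sum_s h s * (s y \in A)%:R.
  move=> zY; rewrite (reindex_inj (mulgI (tperm y z))) /=.
  apply: eq_bigr => s _; rewrite permM tpermR; congr (_ * _).
  apply: hY => x xY; rewrite permM tpermD //.
    by apply: contraNneq yY => ->.
  by apply: contraNneq zY => ->.
have sumE : \sum_(z | z \notin Y) \sum_s h s * (s z \in A)%:R =
    #|~: Y|%:R * \sum_s h s * (s y \in A)%:R.
  rewrite (eq_bigr (fun=> \sum_s h s * (s y \in A)%:R)) // sumr_const mulr_natl.
  by congr (_ *+ _); apply: eq_card => z; rewrite !inE.
apply: (@le_trans _ _ (#|~: Y|%:R * \sum_s h s * (s y \in A)%:R)); last first.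
  rewrite ler_wpM2r ?ler_nat ?max_card //.
  by apply: sumr_ge0 => s _; rewrite mulr_ge0.
rewrite -sumE exchange_big /= mulr_sumr; apply: ler_sum => s _.
rewrite -mulr_sumr mulrC ler_wpM2l //.
have -> : \sum_(z | z \notin Y) (s z \in A)%:R = #|s @^-1: A :\: Y|%:R :> R.
  rewrite -sum1_card natr_sum [LHS]big_mkcond [RHS]big_mkcond /=; apply: eq_bigr => z _.
  by rewrite !inE; case: (z \in Y); case: (s z \in A).
rewrite lerBlDr -natrD ler_nat.
rewrite -[X in (X <= _)%N](card_preimset A (@perm_inj _ s)).
rewrite -(cardsID Y) addnC leq_add2l; exact/subset_leq_card/subsetIr.
Qed.

Definition block_event (b : seq (U * {set U})) s : bool := all (fun c : U * {set U} => s c.1 \in c.2) b.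

(** The points of the block are revealed one by one. At most [#|Y| + size b] targets are used up by
    then, so [sum_perm_next] gives each point conditional probability at least [beta] of hitting its
    target. The weight [h] carries what has been revealed before. *)
Lemma sum_perm_block (beta d : R) b Y h :
  0 <= beta ->
  uniq (map fst b) -> {in map fst b, forall y, y \notin Y} ->
  (forall c, c \in b -> d <= #|c.2|%:R) ->
  beta * #|U|%:R <= d - #|Y|%:R - (size b)%:R ->
  (forall s, 0 <= h s) -> depends_on Y h ->
  beta ^+ size b * \sum_s h s <= \sum_s h s * (block_event b s)%:R.
Proof.
move=> beta0; elim: b Y h => [|[y A] b IH] Y h /=.
  by move=> *; rewrite mul1r; under [leRHS]eq_bigr do rewrite mulr1.
move=> /andP[yb ub] bY dA bd h0 hY.
have yY : y \notin Y by apply: bY; rewrite mem_head.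
have dyA : d <= #|A|%:R by apply: (dA (y, A)); rewrite mem_head.
have step : beta * \sum_s h s <= \sum_s h s * (s y \in A)%:R.
  have [/card0_eq U0|] := posnP #|U|; first by have := U0 y.
  rewrite -(ltr0n R) => Upos; rewrite -(ler_pM2l Upos).
  apply: le_trans (@sum_perm_next Y h y A yY h0 hY).
  rewrite mulrA ler_wpM2r ?sumr_ge0 // mulrC.
  have : 0 <= (size b).+1%:R :> R by [].
  lra.
rewrite exprSr -mulrA; apply: le_trans (_ : _ <= beta ^+ size b *
  \sum_s h s * (s y \in A)%:R) _; first by rewrite ler_wpM2l // exprn_ge0.
apply: le_trans (IH (y |: Y)%SET _ ub _ _ _ _ _) _.
- move=> z zb; rewrite !inE negb_or bY ?inE ?zb ?orbT // andbT.
  by apply: contraNneq yb => <-.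
- by move=> c cb; apply: dA; rewrite inE cb orbT.
- apply: le_trans bd _; rewrite cardsU1 yY add1n -!natr1; lra.
- by move=> s; rewrite mulr_ge0.
- move=> s t st; congr (_ * _); last by rewrite st // setU11.
  by apply: hY => x xY; apply: st; rewrite inE xY orbT.
apply: ler_sum => s _; rewrite -mulrA -natrM mulnb //.
Qed.

(** Conditionally on the earlier blocks, the next one holds with probability at least [beta ^+ k],
    which costs a factor [1 - (1 - t) * beta ^+ k]. Its outcome is absorbed into the weight [h'] and
    its points into [Y']. *)
Lemma sum_perm_blocks (beta d t : R) (k : nat) bs Y h :
  0 <= beta <= 1 -> 0 <= t <= 1 ->
  uniq (map fst (flatten bs)) -> {in map fst (flatten bs), forall y, y \notin Y} ->
  (forall b, b \in bs -> (size b <= k)%N) ->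
  (forall c, c \in flatten bs -> d <= #|c.2|%:R) ->
  beta * #|U|%:R <= d - #|Y|%:R - (k * size bs)%:R ->
  (forall s, 0 <= h s) -> depends_on Y h ->
  \sum_s h s * t ^+ count (block_event^~ s) bs <=
    (1 - (1 - t) * beta ^+ k) ^+ size bs * \sum_s h s.
Proof.
move=> /andP[beta0 beta1] /andP[t0 t1]; elim: bs Y h => [|b bs IH] Y h /=.
  by move=> *; rewrite mul1r; under eq_bigr do rewrite mulr1.
rewrite map_cat cat_uniq => /and3P[ub /hasPn nb ubs] bY bk dA bd h0 hY.
have sb : (size b <= k)%N by apply: bk; rewrite mem_head.
have sbR : (size b)%:R <= k%:R :> R by rewrite ler_nat.
have q0 : 0 <= beta ^+ k by rewrite exprn_ge0.
have q1 : beta ^+ k <= 1 by rewrite exprn_ile1.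
have bdE : (k * (size bs).+1)%:R = k%:R + (k * size bs)%:R :> R.
  by rewrite mulnS natrD.
have kbs0 : 0 <= (k * size bs)%:R :> R by [].
pose h' s := h s * t ^+ block_event b s.
pose Y' := (Y :|: [set y in map fst b])%SET.
have -> : \sum_s h s * t ^+ (block_event b s + count (block_event^~ s) bs) =
    \sum_s h' s * t ^+ count (block_event^~ s) bs.
  by apply: eq_bigr => s _; rewrite exprD mulrA.
apply: le_trans (IH Y' h' ubs _ _ _ _ _ _) _.
- move=> y ybs; rewrite !inE negb_or bY ?mem_cat ?ybs ?orbT //=.
  exact: nb.
- by move=> c cbs; apply: bk; rewrite inE cbs orbT.
- by move=> c cbs; apply: dA; rewrite mem_cat cbs orbT.
- apply: le_trans bd _; rewrite bdE.
  have : #|Y'|%:R <= #|Y|%:R + (size b)%:R :> R.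
    rewrite -natrD ler_nat (leq_trans (leq_card_setU _ _)) // leq_add2l.
    by rewrite cardsE (leq_trans (card_size _)) // size_map.
  lra.
- by move=> s; rewrite mulr_ge0 ?exprn_ge0.
- move=> s s' ss'; congr (_ * _).
    by apply: hY => x xY; apply: ss'; rewrite inE xY.
  congr (t ^+ (nat_of_bool _)); apply: eq_in_all => c cb.
  by rewrite ss' // !inE map_f ?orbT.
rewrite exprSr -mulrA ler_wpM2l ?exprn_ge0 //; first by nra.
have -> : \sum_s h' s = \sum_s h s - (1 - t) * \sum_s h s * (block_event b s)%:R.
  rewrite mulr_sumr -sumrB; apply: eq_bigr => s _; rewrite /h'.
  by case: (block_event b s); rewrite /= ?expr0 ?expr1 ?mulr0n ?mulr1n; ring.
have : beta ^+ size b * \sum_s h s <= \sum_s h s * (block_event b s)%:R.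
  apply: (@sum_perm_block beta d b Y h) => //.
  - by move=> y yb; apply: bY; rewrite mem_cat yb.
  - by move=> c cb; apply: dA; rewrite mem_cat cb.
  - by apply: le_trans bd _; rewrite bdE; lra.
have qb : beta ^+ k <= beta ^+ size b by apply: ler_wiXn2l.
have H0 : 0 <= \sum_s h s by apply: sumr_ge0.
move=> H; have : beta ^+ k * \sum_s h s <= \sum_s h s * (block_event b s)%:R.
  by apply: le_trans H; rewrite ler_wpM2r.
nra.
Qed.

(* Markov's inequality for [(4/5) ^+ X], [X] being the number of events of
   [bs] that hold. *)
Lemma card_perm_few_events (beta d : R) (k : nat) bs :
  0 <= beta <= 1 ->
  uniq (map fst (flatten bs)) ->
  (forall b, b \in bs -> (size b <= k)%N) ->
  (forall c, c \in flatten bs -> d <= #|c.2|%:R) ->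
  beta * #|U|%:R <= d - (k * size bs)%:R ->
  #|[set s : {perm U} | (count (block_event^~ s) bs)%:R <
       3 / 4 * (beta ^+ k * (size bs)%:R)]%SET|%:R
    <= expR (- (beta ^+ k * (size bs)%:R / 80)) * (#|U|)`!%:R.
Proof.
move=> beta01 ubs bk dA bd.
have /andP[beta0 beta1] := beta01.
set q := beta ^+ k; set m := size bs; set B := [set s | _]%SET.
have q0 : 0 <= q by rewrite exprn_ge0.
have q1 : q <= 1 by rewrite exprn_ile1.
have mean : \sum_(s : {perm U}) (4 / 5) ^+ count (block_event^~ s) bs <=
    (1 - q / 5) ^+ m * (#|U|)`!%:R.
  have := @sum_perm_blocks beta d (4 / 5) k bs set0 (fun=> 1) beta01.
  have -> : \sum_(s : {perm U}) 1 = (#|U|)`!%:R :> R.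
    rewrite sumr_const -mulr_natl mulr1; congr (_%:R).
    rewrite -[in RHS]cardsT -card_perm; apply: eq_card => s.
    by apply/esym; rewrite unfold_in; apply/subsetP => x _; rewrite in_setT.
  have -> : 1 - (1 - 4 / 5) * beta ^+ k = 1 - q / 5 by rewrite -/q; field.
  under eq_bigr do rewrite mul1r.
  apply=> //; first by lra.
  - by move=> y; rewrite inE.
  - by rewrite cards0 subr0.
have expand : (1 - q / 5) ^+ m <= expR (- (q * m%:R / 5)).
  have -> : - (q * m%:R / 5) = m%:R * - (q / 5) :> R by ring.
  rewrite expRM_natl lerXn2r ?nnegrE ?expR_ge0 //; first by lra.
  exact: expR_ge1Dx.
(* On [B] the count is below [3 / 4 * (q * m)], and 5/4 <= exp(1/4), so the summand is at least
   exp(-3qm/16). Against the mean, at most exp(-qm/5), this leaves the rate 1/5 - 3/16 = 1/80. *)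
have markov : #|B|%:R * expR (- (q * m%:R * (3 / 16))) <=
    \sum_(s : {perm U}) (4 / 5) ^+ count (block_event^~ s) bs.
  rewrite (bigID (fun s => s \in B)) /= -[leLHS]addr0 lerD //; last first.
    by apply: sumr_ge0 => s _; rewrite exprn_ge0 //; lra.
  rewrite mulr_natl -sumr_const; apply: ler_sum => s.
  rewrite inE => /ltW few.
  set c := count _ _ in few *.
  have -> : 4 / 5 = (1 + 4^-1)^-1 :> R by field.
  rewrite exprVn -[leLHS]invrK lef_pV2 ?posrE ?invr_gt0 ?expR_gt0 ?exprn_gt0 //.
  rewrite -expRN opprK.
  apply: (@le_trans _ _ (expR (c%:R * 4^-1))).
    by rewrite expRM_natl lerXn2r ?nnegrE ?expR_ge0 ?expR_ge1Dx //; lra.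
  rewrite ler_expR; lra.
have e0 := expR_gt0 (- (q * m%:R * (3 / 16))).
rewrite -(ler_pM2r e0) [leRHS]mulrAC -expRD.
apply: le_trans markov _; apply: le_trans mean _.
rewrite ler_wpM2r //; apply: le_trans expand _; rewrite ler_expR.
have : 0 <= q * m%:R by rewrite mulr_ge0.
lra.
Qed.

(* Only [m] blocks at a time are treated: revealing all of them at once would
   leave too few unused points in the target sets. *)
Lemma card_perm_few_events_chunks (beta d : R) (k m a : nat) bs :
  0 <= beta <= 1 ->
  uniq (map fst (flatten bs)) ->
  (forall b, b \in bs -> (size b <= k)%N) ->
  (forall c, c \in flatten bs -> d <= #|c.2|%:R) ->
  beta * #|U|%:R <= d - (k * m)%:R ->
  (a * m <= size bs)%N ->
  #|[set s : {perm U} | (count (block_event^~ s) bs)%:R <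
       3 / 4 * (beta ^+ k * (a * m)%:R)]%SET|%:R
    <= a%:R * (expR (- (beta ^+ k * m%:R / 80)) * (#|U|)`!%:R).
Proof.
move=> beta01; have /andP[beta0 beta1] := beta01.
elim: a bs => [|a IH] bs ubs bk dA bd abs.
  by rewrite !mul0n mulr0 mulr0 mul0r (eq_card0 (A := _)) // => s; rewrite !inE ltNge ler0n.
have m_bs : (m <= size bs)%N by apply: leq_trans abs; rewrite mulSn leq_addr.
move: ubs; rewrite -{1}(cat_take_drop m bs) flatten_cat map_cat cat_uniq => /and3P[ut _ ud].
have szt : size (take m bs) = m by rewrite size_takel.
have memt b : b \in take m bs -> b \in bs by apply: mem_take.
have memd b : b \in drop m bs -> b \in bs by apply: mem_drop.
have {}IH := IH (drop m bs) ud (fun b bb => bk b (memd b bb)).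
have fl (bs' : seq (seq (U * {set U}))) : {subset bs' <= bs} ->
    {subset flatten bs' <= flatten bs}.
  by move=> sub c /flattenP[b /sub bb cb]; apply/flattenP; exists b.
have first := @card_perm_few_events beta d k (take m bs) beta01 ut
  (fun b bb => bk b (memt b bb)) (fun c cc => dA c (fl _ memt c cc)).
rewrite szt in first.
have {}first := first bd.
have {}IH := IH (fun c cc => dA c (fl _ memd c cc)) bd.
rewrite size_drop leq_subRL // -mulSn in IH.
have {}IH := IH abs.
(* If few events hold overall, then few hold among the first [m] blocks or few among the rest; a
   union bound follows. *)
apply: (@le_trans _ _ (#|[set s : {perm U} | (count (block_event^~ s) (take m bs))%:R <
       3 / 4 * (beta ^+ k * m%:R)]%SET|%:R +
   #|[set s : {perm U} | (count (block_event^~ s) (drop m bs))%:R <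
       3 / 4 * (beta ^+ k * (a * m)%:R)]%SET|%:R)); last first.
  have aS (z : R) : a.+1%:R * z = a%:R * z + z by rewrite -natr1 mulrDl mul1r.
  by rewrite aS addrC; apply: lerD.
rewrite -natrD ler_nat; apply: leq_trans (leq_card_setU _ _).
apply/subset_leq_card/subsetP => s; rewrite !inE.
rewrite -{1}(cat_take_drop m bs) count_cat mulSn !natrD.
apply: contraLR; rewrite negb_or -!leNgt => /andP[].
lra.
Qed.

End UniformPermutation.

(** * Scattered vertex sets and cloned graphs *)

Section Adjacency.
Variable T : finType.
Implicit Types (G : sgraph T).

Lemma adjC G u v : adj G u v = adj G v u.
Proof. by rewrite /adj setUC. Qed.

Lemma adjxx G u : adj G u u = false.
Proof.
apply/negP => /(forall_inP (edges_card2 G)).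
by rewrite setUid cards1.
Qed.

Lemma adj_neq G u v : adj G u v -> u != v.
Proof. by apply: contraTneq => ->; rewrite adjxx. Qed.

Definition closed_nbhd G x : {set T} := x |: nbhd G x.

Lemma card_bigcup_le (P : {set T}) (N : T -> {set T}) k :
  (forall x, x \in P -> #|N x| <= k)%N -> (#|\bigcup_(x in P) N x| <= #|P| * k)%N.
Proof.
move=> Nk; rewrite -sum_nat_const; elim/big_ind2: _; first by rewrite cards0.
  by move=> A1 n1 A2 n2 le1 le2; rewrite (leq_trans (leq_card_setU _ _)) // leq_add.
exact: Nk.
Qed.

(* [I] is a maximal set of vertices of [S] with closed neighbourhoods inside
   [S] and pairwise disjoint; any other such vertex is at distance at most two
   from [I]. *)
Lemma exists_scattered_set F (S : {set T}) d :
  (0 < d)%N -> max_degree F = d ->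
  exists I : {set T},
    [/\ I \subset S, forall x, x \in I -> nbhd F x \subset S,
        forall x y, x \in I -> y \in I -> x != y ->
          [disjoint closed_nbhd F x & closed_nbhd F y]
      & (#|T| <= d.+1 * #|~: S| + d * d.+1 * #|I|)%N].
Proof.
move=> d0 Fd.
have degF x : (#|nbhd F x| <= d)%N by rewrite -Fd (leq_bigmax_cond (F := fun x => #|nbhd F x|)).
have cdegF x : (#|closed_nbhd F x| <= d.+1)%N.
  by rewrite cardsU1 -add1n leq_add ?leq_b1.
pose S' := [set x in S | nbhd F x \subset S]%SET.
pose good (I : {set T}) := (I \subset S') && [forall x in I, forall y in I, (x != y) ==>
  [disjoint closed_nbhd F x & closed_nbhd F y]].
have good0 : good set0.
  by rewrite /good sub0set; apply/forall_inP => x; rewrite inE.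
case: (arg_maxnP (fun I : {set T} => #|I|) good0) => I /andP[IS' /forall_inP Idis] Imax.
have {}Idis x y : x \in I -> y \in I -> x != y ->
    [disjoint closed_nbhd F x & closed_nbhd F y].
  by move=> /Idis/forall_inP xI /xI /implyP.
exists I; split=> //.
- by apply: (subset_trans IS'); apply/subsetP => x; rewrite inE => /andP[].
- by move=> x /(subsetP IS'); rewrite inE => /andP[].
(* A vertex outside [S'] lies in the closed neighbourhood of some vertex outside [S]. *)
have nS' : (#|~: S'| <= #|~: S| * d.+1)%N.
  apply: leq_trans (card_bigcup_le (fun x _ => cdegF x)).
  apply/subset_leq_card/subsetP => x; rewrite !inE negb_and => xS.
  apply/bigcupP; case: (boolP (x \in S)) xS => /= [xS /subsetPn[y yx yS]|xS _].
    by exists y; rewrite ?inE // adjC; move: yx; rewrite inE => ->; rewrite orbT.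
  by exists x; rewrite ?inE ?eqxx.
pose ball2 x := x |: \bigcup_(z in nbhd F x) closed_nbhd F z.
have ball2d x : (#|ball2 x| <= d * d.+1)%N.
  (* If [x] has a neighbour, then [x] is already in the union and costs nothing extra; if not, the
     ball is a single point and [d0] is used. *)
  rewrite /ball2; have [->|[z zx]] := set_0Vmem (nbhd F x).
    by rewrite big_set0 setU0 cards1 muln_gt0 d0.
  rewrite (setUidPr _) ?sub1set; last first.
    by apply/bigcupP; exists z; rewrite // !inE adjC; move: zx; rewrite inE => ->; rewrite orbT.
  apply: leq_trans (card_bigcup_le (k := d.+1) _) _ => [z' _ //|].
  by rewrite leq_mul2r degF orbT.
(* By maximality: a vertex of [S'] missed by all the balls could be added to [I]. *)
have cover : S' \subset \bigcup_(x in I) ball2 x.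
  apply/subsetP => y yS'; apply/negPn/negP => /bigcupP yball.
  have disj x : x \in I -> [disjoint closed_nbhd F x & closed_nbhd F y].
    move=> xI; apply/pred0P => w /=; apply/negP => /andP[wx wy]; apply: yball.
    exists x => //; move: wx wy; rewrite !inE.
    move=> /orP[/eqP->|xw] /orP[/eqP yw|yw].
    - by rewrite yw eqxx.
    - by apply/orP; right; apply/bigcupP; exists y; rewrite !inE ?eqxx // adjC.
    - by apply/orP; right; apply/bigcupP; exists y; rewrite !inE ?eqxx // -yw.
    - by apply/orP; right; apply/bigcupP; exists w; rewrite !inE // adjC yw orbT.
  have yI : y \notin I.
    by apply/negP => yI; apply: yball; exists y; rewrite // !inE eqxx.
  have : good (y |: I).
    apply/andP; split; first by rewrite subUset sub1set yS'.
    apply/forall_inP => x; rewrite !inE => xI; apply/forall_inP => x'; rewrite !inE => xI'.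
    apply/implyP; case/orP: xI => [/eqP->|xI]; case/orP: xI' => [/eqP->|xI'].
    - by rewrite eqxx.
    - by rewrite disjoint_sym disj.
    - by rewrite disj.
    - exact: Idis.
  by move=> /Imax; rewrite /= cardsU1 yI add1n ltnn.
have S'I : (#|S'| <= #|I| * (d * d.+1))%N.
  exact: leq_trans (subset_leq_card cover) (card_bigcup_le (fun x _ => ball2d x)).
rewrite -(cardsC S') addnC [X in (_ <= X + _)%N]mulnC [X in (_ <= _ + X)%N]mulnC.
exact: leq_add.
Qed.

End Adjacency.

Lemma contains_copyS (T U : finType) (F : sgraph T) (G H : sgraph U) :
  edges G \subset edges H -> contains_copy F G -> contains_copy F H.
Proof.
move=> /subsetP GH /existsP[f /andP[fi /forallP fc]].
apply/existsP; exists f; rewrite /is_copy fi; apply/forallP => x; apply/forallP => y.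
by apply/implyP => /(implyP (forallP (fc x) y)) /GH.
Qed.

Section Clones.
Variable n : nat.
Implicit Types (g Ga : sgraph 'I_n) (e : {set 'I_(2 * n)}).

Lemma lo_subproof (i : 'I_n) : (i < 2 * n)%N.
Proof. by rewrite mul2n -addnn ltn_addr. Qed.
Lemma hi_subproof (i : 'I_n) : (n + i < 2 * n)%N.
Proof. by rewrite mul2n -addnn ltn_add2l. Qed.
Lemma base_subproof (j : 'I_(2 * n)) : ((if j < n then j : nat else j - n) < n)%N.
Proof. by case: (ltnP j n) => // nj; rewrite ltn_subLR // addnn -mul2n. Qed.

Definition lo i := Ordinal (lo_subproof i).
Definition hi i := Ordinal (hi_subproof i).
Definition base j := Ordinal (base_subproof j).
Definition low : {set 'I_(2 * n)} := [set j : 'I_(2 * n) | (j < n)%N].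

Lemma loK : cancel lo base.
Proof. by move=> i; apply: val_inj; rewrite /= ltn_ord. Qed.
Lemma hiK : cancel hi base.
Proof. by move=> i; apply: val_inj; rewrite /= ltnNge leq_addr addKn. Qed.
Lemma lo_low i : lo i \in low. Proof. by rewrite inE /= ltn_ord. Qed.
Lemma hi_low i : hi i \notin low. Proof. by rewrite inE /= -leqNgt leq_addr. Qed.
Lemma lo_hi j : j = lo (base j) \/ j = hi (base j).
Proof.
case: (ltnP j n) => jn; [left|right]; apply: val_inj; rewrite /=; first by rewrite jn.
by rewrite ltnNge jn subnKC.
Qed.

(** Ignoring pairs of lower clones leaves three preimages per pair instead of four, which is what
    the budget p/2 + 3 (p/6) = p allows. The second test drops the pair of clones of one vertex. *)
Definition project e : option {set 'I_n} :=
  if (e \subset low) || (#|base @: e| != 2)%N then None else Some (base @: e).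

Lemma imset_pair (T U : finType) (f : T -> U) x y :
  f @: [set x; y] = [set f x; f y].
Proof. by rewrite imsetU1 imset_set1. Qed.

Lemma project_pair u v : ~~ ((u \in low) && (v \in low)) -> base u != base v ->
  project [set u; v] = Some [set base u; base v].
Proof.
by move=> uv buv; rewrite /project imset_pair cards2 buv subUset !sub1set (negbTE uv).
Qed.

Lemma card_project_fibre (d : {set 'I_n}) :
  (#|[set e : {set 'I_(2 * n)} | (#|e| == 2) && (project e == Some d)]| <= 3)%N.
Proof.
have [d2|d2] := boolP (#|d| == 2)%N; last first.
  rewrite (eq_card0 (A := _)) // => e; rewrite inE; apply/negP => /andP[_].
  rewrite /project; case: ifP => // /norP[_]; rewrite negbK => de /eqP[] dE.
  by rewrite dE (negbTE d2) in de.
have /cards2P[i [j [ij ->]]] := d2.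
apply: leq_trans (_ : #|[set [set lo i; hi j]; [set hi i; lo j]; [set hi i; hi j]]| <= 3)%N; last first.
  by rewrite (leq_trans (leq_card_setU _ _)) // cards1 addn1 ltnS cards2 ltnS leq_b1.
apply/subset_leq_card/subsetP => e; rewrite inE => /andP[/cards2P[u [v [uv ->]]]].
rewrite /project; case: ifP => //; rewrite subUset !sub1set imset_pair => nlow /eqP[] E.
wlog [bu bv] : u v uv nlow E / base u = i /\ base v = j.
  move=> wl; have iuv : i \in [set base u; base v] by rewrite E !inE eqxx.
  have juv : j \in [set base u; base v] by rewrite E !inE eqxx orbT.
  move: iuv juv; rewrite !in_set2 => /orP[]/eqP iE /orP[]/eqP jE.
  - by rewrite iE jE eqxx in ij.
  - by apply: wl.
  - rewrite [[set u; v]]setUC; apply: wl => //; first by rewrite eq_sym.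
      by rewrite andbC [[set base v; base u]]setUC.
    by rewrite setUC.
  - by rewrite iE jE eqxx in ij.
rewrite !inE.
case: (lo_hi u) nlow => ->; case: (lo_hi v) => ->; rewrite bu bv ?lo_low ?eqxx ?orbT //.
Qed.

Lemma clone_subproof Ga g :
  [forall e in [set e : {set 'I_(2 * n)} | (#|e| == 2) && (base @: e \in
     (if e \subset low then edges g else edges Ga))], #|e| == 2%N].
Proof. by apply/forall_inP => e; rewrite inE => /andP[]. Qed.

(* [g] on the lower clones, and all other clones of the edges of [Ga]. *)
Definition clone_graph Ga g : sgraph 'I_(2 * n) := SGraph (clone_subproof Ga g).

Lemma adj_clone Ga g u v : adj (clone_graph Ga g) u v =
  adj (if (u \in low) && (v \in low) then g else Ga) (base u) (base v).
Proof.
rewrite /adj inE imset_pair subUset !sub1set cards2.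
set H := if _ then g else Ga.
have -> : (if (u \in low) && (v \in low) then edges g else edges Ga) = edges H.
  by rewrite /H; case: ifP.
case: (boolP ([set base u; base v] \in edges H)) => [|_]; last by rewrite andbF.
by move=> /(@adj_neq _ H) uv; rewrite andbT (contra_neq _ uv) // => ->.
Qed.

End Clones.

(** * Switching *)

Section Switching.
Variables (n : nat) (T : finType) (F : sgraph T) (S I : {set T}).
Variables (phi : T -> 'I_n) (Ga g : sgraph 'I_n).
Hypotheses (phi_inj : injective phi) (IS : I \subset S).
Hypothesis I_inside : forall x, x \in I -> nbhd F x \subset S.
Hypothesis I_indep : forall x y, x \in I -> y \in I -> ~~ adj F x y.
Hypothesis phi_copy :
  forall x y, x \in S -> y \in S -> adj F x y -> adj g (phi x) (phi y).

(* A vertex [x] of [I] may leave its place to [v] if its neighbours are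
   embedded into [Ga]-neighbours of the point reserved for [v]. *)
Definition switchable v : {set T} :=
  [set x in I | phi @: nbhd F x \subset nbhd Ga (phi v)].

Definition host v : {set 'I_(2 * n)} := [set hi (phi x) | x in switchable v].

Definition lo_copy : {ffun {x : T | x \in S} -> 'I_(2 * n)} :=
  [ffun x => lo (phi (val x))].

Lemma adj_induced (x y : {x : T | x \in S}) :
  adj (induced_subgraph F S) x y = adj F (val x) (val y).
Proof. by rewrite /adj inE imset_pair. Qed.

Lemma lo_copyP : is_copy (induced_subgraph F S) (clone_graph Ga g) lo_copy.
Proof.
apply/andP; split.
  apply/injectiveP => x y; rewrite !ffunE => /(can_inj (@loK n))/phi_inj.
  exact: val_inj.
apply/forallP => x; apply/forallP => y; apply/implyP; rewrite adj_induced !ffunE.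
rewrite adj_clone !lo_low !loK; apply: phi_copy; exact: valP.
Qed.

Lemma host_disjoint v :
  host v \subset ~: [set lo_copy x | x : {x : T | x \in S}].
Proof.
apply/subsetP => j /imsetP[x _ ->]; rewrite inE; apply/imsetP => -[y _].
by rewrite ffunE => E; have := hi_low (phi x); rewrite E lo_low.
Qed.

(** Adjacency to an upper clone is decided by [Ga] alone, whichever clone [w] is, so the count can
    be made in terms of [base w]. *)
Lemma card_host v w :
  (#|[set x in I | (phi x \in nbhd Ga (base w)) &&
        (phi @: nbhd F x \subset nbhd Ga (phi v))]|
    <= #|host v :&: nbhd (clone_graph Ga g) w|)%N.
Proof.
have hphi : injective (fun x => hi (phi x)) by move=> x y /(can_inj (@hiK n))/phi_inj.
rewrite -(card_imset _ hphi); apply/subset_leq_card/subsetP => j /imsetP[x].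
rewrite !inE => /and3P[xI xw xv] ->; apply/andP; split.
  by apply/imsetP; exists x; rewrite // inE xI.
by rewrite adj_clone (negbTE (hi_low _)) andbF hiK.
Qed.

Section Extension.
Variables (g2 : sgraph 'I_(2 * n)) (f : {ffun T -> 'I_(2 * n)}).
Hypothesis f_copy : is_copy F (graph_union (clone_graph Ga g) g2) f.
Hypothesis f_lo : forall x, x \in S -> f x = lo (phi x).
Hypothesis f_host : forall v, v \notin S -> f v \in host v.

Let f_inj : injective f. Proof. by apply/injectiveP; case/andP: f_copy. Qed.

(** Here [v] takes the place of [x]. As [f] and [phi] are injective, this is a matching between part
    of [I] and the complement of [S]. *)
Let matched x v := [&& x \in I, v \notin S & f v == hi (phi x)].

Let matched_host v : v \notin S -> exists2 x, matched x v & x \in switchable v.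
Proof.
move=> vS; have /imsetP[x xv fv] := f_host vS; exists x => //.
by move: xv; rewrite inE /matched vS fv eqxx => /andP[->].
Qed.

Let matched_funl x v v' : matched x v -> matched x v' -> v = v'.
Proof. by move=> /and3P[_ _ /eqP fv] /and3P[_ _ /eqP fv']; apply: f_inj; rewrite fv. Qed.

Let matched_funr x x' v : matched x v -> matched x' v -> x = x'.
Proof.
move=> /and3P[_ _ /eqP fv] /and3P[_ _ /eqP]; rewrite fv.
by move=> /(can_inj (@hiK n))/phi_inj.
Qed.

Let matchedS x v : matched x v -> (x \in S) && (v \notin S).
Proof. by case/and3P => /(subsetP IS) ->. Qed.

(* Exchanges every [v] outside [S] with the vertex whose place it takes. *)
Let swap z := odflt z [pick y | matched z y || matched y z].

Let swapl x v : matched x v -> swap x = v.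
Proof.
rewrite /swap => xv; have /andP[xS vS] := matchedS xv.
case: pickP => [y /orP[xy|/matchedS/andP[_]]|/(_ v)] /=; first exact: matched_funl xy xv.
  by rewrite xS.
by rewrite xv.
Qed.

Let swapr x v : matched x v -> swap v = x.
Proof.
rewrite /swap => xv; have /andP[xS vS] := matchedS xv.
case: pickP => [y /orP[/matchedS/andP[]|yv]|/(_ x)] /=; first by rewrite (negbTE vS).
  exact: matched_funr yv xv.
by rewrite xv orbT.
Qed.

Let swap_cases x : x \in S -> swap x = x \/ exists2 v, matched x v & x \in I.
Proof.
rewrite /swap => xS; case: pickP => [y /orP[xy|/matchedS/andP[_]]|_]; last by left.
  by right; exists y; rewrite //; case/and3P: xy.
by rewrite xS.
Qed.

Let swapK : involutive swap.
Proof.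
move=> z; have [zS|/matched_host[x xz _]] := boolP (z \in S).
  by have [E|[v zv _]] := swap_cases zS; rewrite ?E // (swapl zv) (swapr zv).
by rewrite (swapr xz) (swapl xz).
Qed.

Let swap_fix x : x \in S -> x \notin I -> swap x = x.
Proof. by move=> /swap_cases[//|[v _ ->]]. Qed.

Let base_out v : v \notin S -> base (f v) = phi (swap v).
Proof.
by move=> /matched_host[x xv _]; rewrite (swapr xv); case/and3P: xv => _ _ /eqP ->; rewrite hiK.
Qed.

Let target := graph_union Ga (graph_of (edges g :|: pimage (@project n) (edges g2))).

(** At both ends [base \o f] agrees with [phi \o swap], and [f x] is an upper clone. So the edge
    used by [f] comes either from [Ga] or from an edge of [g2] that [project] keeps. *)
Let adj_out x y : adj F x y -> x \notin S -> adj target (phi (swap x)) (phi (swap y)).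
Proof.
move=> xy xS.
(* A neighbour [y] of [x] lying in [S] is not in [I], since neighbourhoods of vertices of [I] stay
   inside [S]; hence [swap] fixes it. *)
have basey : base (f y) = phi (swap y).
  have [yS|/base_out//] := boolP (y \in S).
  rewrite swap_fix ?f_lo ?loK //.
  apply: contra xS => /I_inside/subsetP; apply.
  by rewrite inE adjC.
have fx_low : f x \notin low n.
  by have /imsetP[z _ ->] := f_host xS; apply: hi_low.
have bxy : base (f x) != base (f y).
  rewrite basey base_out // (inj_eq phi_inj) (inj_eq (inv_inj swapK)).
  exact: adj_neq xy.
have /andP[_ /forallP/(_ x)/forallP/(_ y)/implyP/(_ xy)] := f_copy.
rewrite -basey -(base_out xS) {1}/adj inE => /orP[|].
  by rewrite -/(adj _ _ _) adj_clone (negbTE fx_low) /= /adj !inE => ->.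
move=> e2; rewrite /adj !inE cards2 bxy andbT; apply/orP; right; apply/orP; right.
apply/exists_inP; exists [set f x; f y] => //.
by rewrite project_pair // (negbTE fx_low).
Qed.

Lemma switched_copy : contains_copy F target.
Proof.
apply/existsP; exists [ffun x => phi (swap x)]; apply/andP; split.
  by apply/injectiveP => x y; rewrite !ffunE => /phi_inj/(inv_inj swapK).
apply/forallP => x; apply/forallP => y; apply/implyP => xy; rewrite !ffunE.
have [xS|] := boolP (x \in S); last exact: adj_out.
have [yS|] := boolP (y \in S); last by rewrite adjC; apply: adj_out; rewrite adjC.
(* A moved vertex [z] goes to [phi v]; its neighbour [t] stays put because [I] is independent, and
   switchability provides the edge in [Ga]. *)
have moved z t v : adj F z t -> t \in S -> matched z v -> z \in I ->
    adj target (phi (swap z)) (phi (swap t)).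
  move=> zt tS zv zI; rewrite (swapl zv) swap_fix //; last first.
    by apply: contraL zt => tI; apply: I_indep.
  have /andP[_ vS] := matchedS zv.
  have [z' z'v] := matched_host vS; rewrite (matched_funr z'v zv) inE => /andP[_].
  move=> /subsetP/(_ (phi t)); rewrite imset_f ?inE // => /(_ isT).
  by rewrite /adj !inE => ->.
have [xx|[v xv xI]] := swap_cases xS; last exact: moved xy yS xv xI.
have [yy|[v yv yI]] := swap_cases yS; last first.
  by rewrite adjC; apply: moved yv yI; rewrite // adjC.
rewrite xx yy /adj !inE; have gxy := phi_copy xS yS xy.
by rewrite (forall_inP (edges_card2 g)) // -/(adj g _ _) gxy orbT.
Qed.

End Extension.

Lemma switch_extension g2 :
  extends_to_copy F lo_copy host (graph_union (clone_graph Ga g) g2) ->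
  contains_copy F (graph_union Ga
    (graph_of (edges g :|: pimage (@project n) (edges g2)))).
Proof.
move=> /existsP[f /and3P[f_copy /forallP f_lo /forallP f_host]].
apply: (switched_copy f_copy) => [x xS|v vS].
  by have /eqP := f_lo (exist _ x xS); rewrite ffunE.
exact: (implyP (f_host v)).
Qed.

End Switching.

(** * Sprinkling and random relabelling *)

Section Sprinkling.
Variables (R : realType) (n : nat) (q : R).
Hypothesis q01 : 0 <= q <= 1.

(** At most three clone pairs project to [e] and (1 - q/6)^3 >= 1 - q/2, so [e] is absent from both
    sources with probability at least (1 - q/2)^2 >= 1 - q. *)
Lemma sprinkled_prob_le (e : {set 'I_n}) :
  1 - (1 - pair_prob (q / 2) e) *
      \prod_(e' | @project n e' == Some e) (1 - pair_prob (q / 6) e') <= pair_prob q e.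
Proof.
have /andP[q0 q1] := q01.
have [e2|e2] := boolP (#|e| == 2)%N; last first.
  rewrite {1 3}/pair_prob (negbTE e2) big1 ?subr0 ?mulr1 ?subrr // => e'.
  rewrite /project; case: ifP => // /norP[_]; rewrite negbK => e'2 /eqP[] e'E.
  by rewrite e'E (negbTE e2) in e'2.
rewrite {1 3}/pair_prob e2.
rewrite (bigID (fun e' : {set 'I_(2 * n)} => #|e'| == 2%N)) /= [X in _ * (_ * X)]big1 ?mulr1; last first.
  by move=> e' /andP[_ e'2]; rewrite /pair_prob (negbTE e'2) subr0.
rewrite (eq_bigr (fun=> 1 - q / 6)) => [|e' /andP[_ e'2]]; last by rewrite /pair_prob e'2.
rewrite (eq_bigl (fun e' => e' \in [set e' : {set 'I_(2 * n)} |
  (#|e'| == 2) && (project e' == Some e)])); last by move=> e'; rewrite inE andbC.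
rewrite prodr_const.
have le1 : 1 - q / 2 <= (1 - q / 6) ^+ 3.
  have -> : (1 - q / 6) ^+ 3 = 1 - q / 2 + (q / 6) ^+ 2 * (3 - q / 6) by field.
  by rewrite lerDl mulr_ge0 ?sqr_ge0 //; lra.
have r0 : 0 <= 1 - q / 6 by lra.
have r1 : 1 - q / 6 <= 1 by lra.
have := le_trans le1 (ler_wiXn2l r0 r1 (card_project_fibre e)).
move: (_ ^+ #|_|) => X le2.
have le3 : (1 - q / 2) * (1 - q / 2) <= (1 - q / 2) * X by rewrite ler_wpM2l //; lra.
have : (1 - q / 2) * (1 - q / 2) = 1 - q + (q / 2) ^+ 2 by field.
have := sqr_ge0 (q / 2); lra.
Qed.

(** By [subset_mean_image] the union of the two sources is a random set with independent elements,
    and its marginals are at most those of G(n, q). Monotonicity of [P] compares the two, and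
    conditioning on the first source gives the product. *)
Lemma gnp_sprinkle (eta : R) (P Q : pred (sgraph 'I_n)) :
  (forall g h : sgraph 'I_n, edges g \subset edges h -> P g -> P h) ->
  (forall g, Q g -> 1 - eta <= gnp_prob (q / 6) [pred g2 |
     P (graph_of (edges g :|: pimage (@project n) (edges g2)))]) ->
  (1 - eta) * gnp_prob (q / 2) Q <= gnp_prob q P.
Proof.
move=> Pmono QP; have /andP[q0 q1] := q01.
have q201 : 0 <= q / 2 <= 1 by apply/andP; split; lra.
have q601 : 0 <= q / 6 <= 1 by apply/andP; split; lra.
have graph_ofS (A B : {set {set 'I_n}}) : A \subset B ->
    edges (graph_of A) \subset edges (graph_of B).
  by move=> /subsetP AB; apply/subsetP => e; rewrite !inE => /andP[/AB -> ->].
rewrite !gnp_probE; pose f A := (P (graph_of A))%:R : R.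
have fmono (A B : {set {set 'I_n}}) : A \subset B -> f A <= f B.
  move=> /graph_ofS/Pmono; rewrite /f; case: (P _) => [/(_ isT) -> //|_].
  by rewrite ler0n.
have coupled := ler_subset_mean_prob (f := f) _ sprinkled_prob_le _ fmono.
apply: (le_trans _ (coupled _ _)) => [|e|e]; last first.
- by have /andP[] := pair_prob01 e q01.
- have /andP[a0 a1] := pair_prob01 e q201.
  rewrite subr_ge0 mulr_ile1 ?subr_ge0 ?gerBl //.
    by apply: prodr_ge0 => e' _; rewrite subr_ge0; have /andP[] := pair_prob01 e' q601.
  rewrite prodr_ile1 // => e' _.
  by have /andP[? ?] := pair_prob01 e' q601; rewrite subr_ge0 gerBl; apply/andP.
rewrite -subset_mean_image.
have -> : (1 - eta) * subset_mean (pair_prob (q / 2)) (fun A => (Q (graph_of A))%:R) =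
    subset_mean (pair_prob (q / 2)) (fun A => (1 - eta) * (Q (graph_of A))%:R).
  by rewrite /subset_mean mulr_sumr; apply: eq_bigr => A _; rewrite mulrCA.
apply: ler_subset_mean => [e|A]; first exact: (pair_prob01 e q201).
case: (boolP (Q (graph_of A))) => [/QP|_]; last first.
  rewrite mulr0 sumr_ge0 // => B _; rewrite mulr_ge0 ?ler0n //.
  by apply: subset_weight_ge0 => e; apply: (pair_prob01 e q601).
rewrite mulr1 gnp_probE => /le_trans; apply.
apply: ler_subset_mean => [e|B]; first exact: (pair_prob01 e q601).
rewrite /f /=; have [PAB|_] := boolP (P (graph_of
  (edges (graph_of A) :|: pimage (@project n) (edges (graph_of B))))); last exact: ler0n.
(* Replacing [A] and [B] by the edge sets of their graphs only removes sets, which the increasing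
   property [P] tolerates. *)
rewrite (Pmono _ _ _ PAB) //; apply: graph_ofS; apply: setUSS.
  by apply/subsetP => e; rewrite inE => /andP[].
apply/subsetP => e; rewrite !inE => /exists_inP[e' e'B Ee']; apply/exists_inP.
by exists e' => //; move: e'B; rewrite inE => /andP[].
Qed.

End Sprinkling.

Section Relabelling.
Variable n : nat.

Lemma relabel_subproof (s : {perm 'I_n}) (g : sgraph 'I_n) :
  [forall e in [set [set s x | x in e] | e : {set 'I_n} in edges g], #|e| == 2%N].
Proof.
apply/forall_inP => _ /imsetP[e eg ->].
by rewrite card_imset ?(forall_inP (edges_card2 g)) //; apply: perm_inj.
Qed.

Definition relabel s g : sgraph 'I_n := SGraph (relabel_subproof s g).

Lemma adj_relabel s g u v : adj (relabel s g) (s u) (s v) = adj g u v.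
Proof. by rewrite /adj /= -imset_pair mem_imset //; apply/imset_inj/perm_inj. Qed.

Lemma relabel_inj s : injective (relabel s).
Proof.
by move=> g h /(congr1 (@edges _)) /(imset_inj (imset_inj (@perm_inj _ s))) /val_inj.
Qed.

Lemma gnp_prob_relabel (R : realType) (q : R) (P : pred (sgraph 'I_n)) s :
  gnp_prob q [pred g | P (relabel s g)] = gnp_prob q P.
Proof.
rewrite /gnp_prob [RHS](reindex_inj (@relabel_inj s)) /=; apply: eq_bigr => g _.
by rewrite (card_imset _ (imset_inj (@perm_inj _ s))).
Qed.

(** G(n, q) is invariant under relabelling, so the probability of [P] is its average over a uniform
    relabelling; exchanging the sums lets the permutation be random for a fixed [g]. *)
Lemma gnp_prob_average (R : realType) (q delta : R) (P Q : pred (sgraph 'I_n)) :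
  0 <= q <= 1 ->
  (forall g, Q g ->
     (1 - delta) * (n`!)%:R <= #|[set s : {perm 'I_n} | P (relabel s g)]|%:R) ->
  (1 - delta) * gnp_prob q Q <= gnp_prob q P.
Proof.
move=> q01 QP; have fact0 : 0 < (n`!)%:R :> R by rewrite ltr0n fact_gt0.
rewrite -(ler_pM2r fact0).
have -> : gnp_prob q P * (n`!)%:R =
    \sum_(s : {perm 'I_n}) gnp_prob q [pred g | P (relabel s g)].
  under eq_bigr do rewrite gnp_prob_relabel.
  rewrite sumr_const mulr_natr; congr (_ *+ _).
  rewrite -[X in (X`!)%N]card_ord -cardsT -card_perm; apply: eq_card => s.
  by rewrite unfold_in; apply/subsetP => x _; rewrite in_setT.
rewrite /gnp_prob mulrAC mulr_sumr.
under [leRHS]eq_bigr do rewrite big_mkcond.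
rewrite [leRHS]exchange_big [leLHS]big_mkcond /=; apply: ler_sum => g _.
rewrite -big_mkcond sumr_const -[leRHS]mulr_natl.
have w0 := gnp_weight_ge0 g q01.
case: ifP => [/QP Qg|_]; last by rewrite mulr_ge0.
rewrite ler_wpM2r // (le_trans Qg) // ler_nat; apply/subset_leq_card/subsetP => s.
by rewrite inE.
Qed.

End Relabelling.

(** * Good embeddings *)

Lemma extend_injection (T U : finType) (S : {set T}) (f : {x : T | x \in S} -> U) :
  #|T| = #|U| -> injective f ->
  exists2 phi : T -> U, injective phi & forall x, phi (val x) = f x.
Proof.
move=> TU f_inj; pose A := f @: setT.
have cA : #|A| = #|S|.
  by rewrite card_imset // cardsT card_sig; apply: eq_card => x; rewrite inE.
have cAC : #|~: A| = #|~: S|.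
  by apply/eqP; rewrite -(eqn_add2l #|A|) cardsC cA cardsC TU.
(* The complements of [S] and [A] are matched in enumeration order. Quantifying over the default
   [u0] avoids assuming that [U] has a point. *)
have nth_out v (vS : v \notin S) : exists2 u, u \notin A &
    forall u0, nth u0 (enum (~: A)) (index v (enum (~: S))) = u.
  have vlt : (index v (enum (~: S)) < size (enum (~: A)))%N.
    by rewrite -cardE cAC cardE index_mem mem_enum inE.
  case E : (enum (~: A)) vlt => [|u s] // vlt.
  exists (nth u (u :: s) (index v (enum (~: S)))).
    by rewrite -in_setC -mem_enum E mem_nth.
  by move=> u0; apply: set_nth_default.
pose good x u := (forall xS : x \in S, u = f (exist _ x xS)) /\
  (x \notin S -> u \notin A /\
     forall u0, nth u0 (enum (~: A)) (index x (enum (~: S))) = u).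
have good_ex x : exists u, good x u.
  have [xS|xS] := boolP (x \in S).
    by exists (f (exist _ x xS)); split=> [xS'|/negP//]; congr f; apply: val_inj.
  have [u uA uE] := nth_out x xS.
  by exists u; split=> [xS'|_]; [by have := xS; rewrite xS' | split].
have [phi phiE] := choice good_ex.
have phi_in x (xS : x \in S) : phi x \in A.
  by rewrite (phiE x).1; apply: imset_f.
exists phi => [x y|[x xS]]; last exact: (phiE x).1.
have [xS|xS] := boolP (x \in S); have [yS|yS] := boolP (y \in S) => E.
- by move: E; rewrite !(phiE _).1 => /f_inj [].
- by have [+ _] := (phiE y).2 yS; rewrite -E phi_in.
- by have [+ _] := (phiE x).2 xS; rewrite E phi_in.
have [_ xE] := (phiE x).2 xS; have [_ yE] := (phiE y).2 yS.
have /eqP := etrans (xE (phi x)) (etrans E (esym (yE (phi x)))).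
rewrite nth_uniq ?enum_uniq // -?cardE ?cAC ?cardE ?index_mem ?mem_enum ?inE //.
move=> /eqP /(congr1 (nth x (enum (~: S)))).
by rewrite !nth_index // mem_enum inE.
Qed.

Lemma uniq_flatten_map (T U : eqType) (s : seq T) (D : T -> seq U) :
  uniq s -> (forall x, x \in s -> uniq (D x)) ->
  (forall x y, x \in s -> y \in s -> x != y -> ~~ has (mem (D x)) (D y)) ->
  uniq (flatten (map D s)).
Proof.
elim: s => //= x s IH /andP[xs us] Du Ddis; rewrite cat_uniq Du ?mem_head //=.
rewrite IH // => [|y ys|y z ys zs]; last 2 first.
- by apply: Du; rewrite inE ys orbT.
- by apply: Ddis; rewrite inE ?ys ?zs orbT.
rewrite andbT; apply/hasPn => u /flatten_mapP[y ys uy].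
have := Ddis x y (mem_head _ _); rewrite inE ys orbT => /(_ isT).
move=> /(_ _)/hasPn; apply=> //.
by apply: contraNneq xs => ->.
Qed.

Section GoodEmbedding.
Variables (R : realType) (n : nat) (T : finType) (F : sgraph T).
Variables (FF : {set {set T}}) (Ga : sgraph 'I_n) (kappa : R).

(** With [u] the point reserved for [v], this becomes the lower bound on degrees into B(v) required
    by (A2), through [card_host]. *)
Definition flexible (I : {set T}) (phi : T -> 'I_n) (u w : 'I_n) :=
  kappa <= #|[set x in I | (phi x \in nbhd Ga w) &&
                (phi @: nbhd F x \subset nbhd Ga u)]|%:R.

Definition good_embedding (g : sgraph 'I_n) : Prop :=
  exists S I : {set T}, exists phi : T -> 'I_n,
  [/\ S \in FF, injective phi,
      [/\ I \subset S, forall x, x \in I -> nbhd F x \subset S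
        & forall x y, x \in I -> y \in I -> ~~ adj F x y],
      forall x y, x \in S -> y \in S -> adj F x y -> adj g (phi x) (phi y)
    & forall u w, flexible I phi u w].

Lemma card_inflexible_perms (alpha beta : R) (k m : nat) (I : {set T}) (phi : T -> 'I_n) u w :
  0 <= beta <= 1 -> injective phi ->
  (forall x, #|closed_nbhd F x| <= k)%N ->
  (forall x y, x \in I -> y \in I -> x != y ->
     [disjoint closed_nbhd F x & closed_nbhd F y]) ->
  min_degree_ge Ga (alpha * n%:R) ->
  beta * n%:R <= alpha * n%:R - (k * m)%:R ->
  (0 < m)%N ->
  kappa <= 3 / 4 * (beta ^+ k * (#|I| %/ m * m)%:R) ->
  #|[set s : {perm 'I_n} | ~~ `[< flexible I (s \o phi) u w >]]|%:R <=
    n%:R * (expR (- (beta ^+ k * m%:R / 80)) * (n`!)%:R).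
Proof.
move=> beta01 phi_inj Fk Idis degGa betam m0 kappaI.
(* The block of [x] says that [x] lands next to [w] and all its neighbours next to [u]. Disjoint
   closed neighbourhoods make the points of all blocks distinct. *)
pose b x := (phi x, nbhd Ga w) :: [seq (phi y, nbhd Ga u) | y <- enum (nbhd F x)].
pose bs := [seq b x | x <- enum I].
have bs_size : size bs = #|I| by rewrite size_map -cardE.
have I_n : (#|I| <= n)%N.
  by rewrite (leq_trans (max_card _)) // -[leqRHS]card_ord (leq_card phi).
have fst_b x : map fst (b x) = map phi (x :: enum (nbhd F x)).
  by rewrite /= -map_comp.
have mem_closed x z : (z \in x :: enum (nbhd F x)) = (z \in closed_nbhd F x).
  by rewrite inE mem_enum !inE.
have ubs : uniq (map fst (flatten bs)).
  rewrite map_flatten -map_comp (eq_map fst_b) (map_comp (map phi)) -map_flatten.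
  rewrite (map_inj_uniq phi_inj); apply: uniq_flatten_map; first exact: enum_uniq.
    by move=> x _; rewrite /= enum_uniq mem_enum inE adjxx.
  move=> x y; rewrite !mem_enum => xI yI xy; apply/hasPn => z; rewrite mem_closed => zy.
  rewrite -[mem _ z]/(z \in x :: enum (nbhd F x)) mem_closed.
  by rewrite (disjointFl (Idis _ _ xI yI xy) zy).
have bk c : c \in bs -> (size c <= k)%N.
  move=> /mapP[x _ ->]; rewrite /= size_map -cardE; apply: leq_trans (Fk x).
  by rewrite cardsU1 inE adjxx add1n.
have dbs c : c \in flatten bs -> alpha * n%:R <= #|c.2|%:R.
  by move=> /flatten_mapP[x _]; rewrite inE => /orP[/eqP->|/mapP[y _ ->]]; apply: degGa.
have betaU : beta * #|'I_n|%:R <= alpha * n%:R - (k * m)%:R by rewrite card_ord.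
have abs : (#|I| %/ m * m <= size bs)%N by rewrite bs_size leq_trunc_div.
have chunks := card_perm_few_events_chunks beta01 ubs bk dbs betaU abs.
rewrite card_ord in chunks.
apply: le_trans (_ : (#|I| %/ m)%:R *
  (expR (- (beta ^+ k * m%:R / 80)) * (n`!)%:R) <= _); last first.
  by rewrite ler_wpM2r ?mulr_ge0 ?expR_ge0 ?ler0n // ler_nat (leq_trans (leq_div _ _)).
apply: le_trans chunks; rewrite ler_nat; apply/subset_leq_card/subsetP => s.
rewrite !inE => /asboolPn/negP; rewrite -ltNge => /lt_le_trans/(_ kappaI).
congr (_%:R < _); rewrite count_map -sum1_count big_enum_cond -sum1_card.
apply: eq_bigl => x; rewrite inE /=; congr (_ && (_ && _)).
rewrite [RHS]all_map; apply/subsetP/allP => [xu y|xu _ /imsetP[y yx ->]].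
  by rewrite mem_enum => yx; apply: xu; apply: imset_f.
by apply: (xu y); rewrite mem_enum.
Qed.

(** A union bound over the n^2 pairs (u, w), each failing for at most a fraction n * exp(...) of the
    permutations, gives the cube. *)
Lemma card_good_relabelings (alpha beta : R) (d m : nat) (S : {set T}) (g : sgraph 'I_n) :
  #|T| = n -> S \in FF -> contains_copy (induced_subgraph F S) g ->
  0 <= beta <= 1 -> (0 < d)%N -> max_degree F = d ->
  min_degree_ge Ga (alpha * n%:R) ->
  beta * n%:R <= alpha * n%:R - (d.+1 * m)%:R ->
  (0 < m)%N ->
  (forall I : {set T}, (#|T| <= d.+1 * #|~: S| + d * d.+1 * #|I|)%N ->
     kappa <= 3 / 4 * (beta ^+ d.+1 * (#|I| %/ m * m)%:R)) ->
  (1 - n%:R ^+ 3 * expR (- (beta ^+ d.+1 * m%:R / 80))) * (n`!)%:R <=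
    #|[set s : {perm 'I_n} | `[< good_embedding (relabel s g) >]]|%:R.
Proof.
move=> Tn SFF /existsP[f /andP[/injectiveP f_inj /forallP f_copy]] beta01 d0 Fd degGa.
move=> betam m0 kappaI.
have Tn' : #|T| = #|'I_n| by rewrite card_ord.
have [phi phi_inj phiE] := extend_injection Tn' f_inj.
have [I [IS I_in Idis cardI]] := exists_scattered_set S d0 Fd.
have Fk x : (#|closed_nbhd F x| <= d.+1)%N.
  rewrite cardsU1 -add1n leq_add ?leq_b1 //.
  by rewrite -Fd (leq_bigmax_cond (F := fun x => #|nbhd F x|)).
pose bad (p : 'I_n * 'I_n) :=
  [set s : {perm 'I_n} | ~~ `[< flexible I (s \o phi) p.1 p.2 >]].
have badE p := card_inflexible_perms p.1 p.2 beta01 phi_inj Fk Idis degGa betam m0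
  (kappaI I cardI).
set good := [set s | _]; set E := expR _ in badE *.
have badC : ~: good \subset \bigcup_p bad p.
  apply/subsetP => s; rewrite !inE => /asboolPn s_bad; apply/bigcupP; apply: contrapT => no_bad.
  apply: s_bad; exists S, I, (s \o phi); split=> //.
  - exact: inj_comp perm_inj phi_inj.
  - split=> // x y xI yI; have [->|xy] := eqVneq x y; first by rewrite adjxx.
    have := disjointFl (Idis x y xI yI xy) (setU11 y _).
    by rewrite !inE => /norP[].
  - move=> x y xS yS xy; rewrite adj_relabel.
    rewrite (phiE (exist _ x xS)) (phiE (exist _ y yS)).
    by apply: (implyP (forallP (f_copy _) _)); rewrite adj_induced.
  - move=> u w; apply: contrapT => uw; apply: no_bad; exists (u, w) => //.
    by rewrite inE; apply/asboolPn.
have sum_bad : #|~: good|%:R <= n%:R ^+ 3 * E * (n`!)%:R.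
  apply: (@le_trans _ _ (\sum_p #|bad p|%:R)).
    rewrite -natr_sum ler_nat; apply: leq_trans (subset_leq_card badC) _.
    elim/big_ind2: _ => // [|A1 n1 A2 n2 le1 le2]; first by rewrite cards0.
    by rewrite (leq_trans (leq_card_setU _ _)) // leq_add.
  apply: le_trans (ler_sum _ (fun p _ => badE p)) _.
  rewrite sumr_const card_prod card_ord -[leLHS]mulr_natl natrM.
  rewrite le_eqVlt; apply/orP; left; apply/eqP; ring.
have total : #|good|%:R + #|~: good|%:R = (n`!)%:R :> R.
  rewrite -natrD cardsC; congr _%:R.
  rewrite -[X in (X`!)%N]card_ord -[X in (X`!)%N]cardsT -card_perm; apply: eq_card => s.
  by apply/esym; rewrite unfold_in; apply/subsetP => x _; rewrite in_setT.
by rewrite mulrBl mul1r lerBlDr -[leLHS]total lerD2l.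
Qed.

End GoodEmbedding.

(* The loss from [31 / 32] and from the floor in the number of blocks is paid
   for by the factor 4 in the definition of [suitable_eps]. *)
Lemma suitable_eps_bound (R : realType) (alpha N i m M : R) (d : nat) :
  0 < alpha <= 1 -> (0 < d)%N -> 0 <= N ->
  N - d.+1%:R * (suitable_eps alpha d * N) <= (d * d.+1)%:R * i ->
  32 * (d.+1%:R ^+ 2 * m) <= alpha * N -> 0 <= m ->
  i - m <= M ->
  4 * suitable_eps alpha d * N <= 3 / 4 * ((31 / 32 * alpha) ^+ d.+1 * M).
Proof.
move=> /andP[a0 a1] d0 N0 iN mN m0 iM.
have D1 : 1 <= d%:R :> R by rewrite ler1n.
have SD : d.+1%:R = d%:R + 1 :> R by rewrite -natr1.
rewrite natrM in iN; rewrite !{}SD in iN mN.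
set eps := suitable_eps alpha d in iN *.
have epsE : eps = (alpha / (4 * d%:R)) ^+ (2 * d) by [].
move: eps epsE iN => eps epsE iN.
move: (d%:R) D1 epsE iN mN => D D1 epsE iN mN.
have [x xE] : exists x, x = alpha / (4 * D) by exists (alpha / (4 * D)).
rewrite -xE in epsE.
have x0 : 0 < x by rewrite xE divr_gt0 // mulr_gt0 //; lra.
have alphaE : alpha = 4 * D * x by rewrite xE; field; lra.
have x1 : x * (4 * D) <= 1 by rewrite mulrC -alphaE.
have x1' : x <= 1 by nra.
have eps0 : 0 <= eps by rewrite epsE exprn_ge0 // ltW.
(* From [eps <= x ^+ 2] and [D * x <= 1 / 4], both [D * eps] and [eps] are at most 1/16. *)
have eps_small : (D + 1) * eps <= 1 / 8.
  have : eps <= x ^+ 2.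
    by rewrite epsE; apply: (ler_wiXn2l (ltW x0) x1'); rewrite leq_pmulr.
  rewrite expr2 => eps2; have : D * x <= 1 / 4 by lra.
  nra.
(* Since [d.+1 <= 2 * d], the power of [x] is at least [eps]; and (31/8)^2 > 15. *)
have eps_beta : 15 * D ^+ 2 * eps <= (31 / 32 * alpha) ^+ d.+1.
  have -> : 31 / 32 * alpha = (31 / 8 * D) * x by rewrite alphaE; field.
  rewrite exprMn.
  have e1 : eps <= x ^+ d.+1.
    by rewrite epsE; apply: (ler_wiXn2l (ltW x0) x1'); rewrite mul2n -addnn -addn1 leq_add2l.
  have e2 : (31 / 8 * D) ^+ 2 <= (31 / 8 * D) ^+ d.+1.
    by apply: ler_weXn2l => //; lra.
  have e3 : 15 * D ^+ 2 <= (31 / 8 * D) ^+ d.+1.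
    apply: le_trans e2; rewrite exprMn ler_wpM2r ?sqr_ge0 //; lra.
  apply: ler_pM => //; rewrite mulr_ge0 ?sqr_ge0 //; lra.
have iN' : 7 / 8 * N <= D * (D + 1) * i.
  have := ler_wpM2r N0 eps_small; rewrite mulrA in iN; lra.
have mN' : 32 * (D * (D + 1) * m) <= N.
  have aN : alpha * N <= N by nra.
  have : D * (D + 1) * m <= (D + 1) ^+ 2 * m.
    by rewrite expr2 ler_wpM2r // ler_wpM2r //; lra.
  lra.
have DD0 : 0 <= D * (D + 1) by rewrite mulr_ge0 //; lra.
(* 27/32 = 7/8 - 1/32. With D + 1 <= 2D this gives N <= 64/27 D^2 M, and the goal follows from 4 *
   64/27 < 15 * 3/4. *)
have MN : 27 / 32 * N <= D * (D + 1) * M by have := ler_wpM2l DD0 iM; lra.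
have M0 : 0 <= M.
  have DD1 : 0 < D * (D + 1) by rewrite mulr_gt0 //; lra.
  by rewrite -(pmulr_rge0 _ DD1); lra.
have D2M : D * (D + 1) * M <= 2 * D ^+ 2 * M.
  by rewrite expr2 ler_wpM2r //; nra.
have := ler_wpM2r M0 eps_beta; move: (_ ^+ d.+1) => b.
have : eps * (27 / 32 * N) <= eps * (2 * D ^+ 2 * M) by rewrite ler_wpM2l //; lra.
have : 0 <= eps * N by rewrite mulr_ge0.
lra.
Qed.

(** * Limits and the proof of the theorem *)

Lemma cube_mul_expRN (R : realType) (C gamma delta : R) : 0 < gamma -> 0 < delta ->
  \forall n \near \oo%classic, n%:R ^+ 3 * (C * expR (- (gamma * n%:R))) <= delta.
Proof.
move=> gamma0 delta0.
have [C0|C0] := leP C 0.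
  near=> n; apply: le_trans (ltW delta0); rewrite mulr_ge0_le0 ?exprn_ge0 //.
  by rewrite mulr_le0_ge0 ?expR_ge0.
pose K := C * (4 / gamma) ^+ 4 / delta.
near=> n.
have n0 : 0 < n%:R :> R by rewrite ltr0n; near: n; exact: nbhs_infty_gt.
have nK : K <= n%:R by near: n; exact: nbhs_infty_ger.
have gn0 : 0 < gamma / 4 * n%:R by rewrite mulr_gt0 // divr_gt0.
(* A quartic lower bound on the exponential is enough to beat the cube. *)
have exp4 : (gamma / 4 * n%:R) ^+ 4 <= expR (gamma * n%:R).
  have -> : gamma * n%:R = 4%:R * (gamma / 4 * n%:R) by field.
  rewrite expRM_natl lerXn2r ?nnegrE ?expR_ge0 ?ltW //.
  by apply: lt_le_trans (expR_ge1Dx _); rewrite ltrDr.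
rewrite expRN mulrA ler_pdivrMr ?expR_gt0 //.
apply: le_trans (_ : delta * (gamma / 4 * n%:R) ^+ 4 <= _); last by rewrite ler_wpM2l // ltW.
have -> : n%:R ^+ 3 * C = K * (delta * (gamma / 4) ^+ 4 * n%:R ^+ 3).
  by rewrite /K; field; rewrite !gt_eqF.
have -> : delta * (gamma / 4 * n%:R) ^+ 4 = n%:R * (delta * (gamma / 4) ^+ 4 * n%:R ^+ 3).
  by field.
rewrite ler_wpM2r // !mulr_ge0 ?exprn_ge0 ?ltW // divr_gt0.
Unshelve. all: by end_near.
Qed.

Lemma contains_copy_max_degree0 (T U : finType) (F : sgraph T) (G : sgraph U) :
  #|T| = #|U| -> max_degree F = 0%N -> contains_copy F G.
Proof.
move=> TU F0; pose f0 (x : {x : T | x \in (set0 : {set T})}) : U :=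
  let: exist y y0 := x in False_rect U (elimF idP (in_set0 y) y0).
have f0_inj : injective f0 by move=> [x x0]; have := x0; rewrite inE.
have [phi phi_inj _] := extend_injection TU f0_inj.
apply/existsP; exists [ffun x => phi x]; apply/andP; split.
  by apply/injectiveP => x y; rewrite !ffunE => /phi_inj.
apply/forallP => x; apply/forallP => y; apply/implyP => xy.
have : (#|nbhd F x| <= 0)%N by rewrite -F0 (leq_bigmax_cond (F := fun x => #|nbhd F x|)).
by rewrite leqn0 cards_eq0 => /eqP/setP/(_ y); rewrite !inE xy.
Qed.

Lemma whp_leP (R : realType) (P : nat -> R) : (forall n, P n <= 1) ->
  whp P <-> forall eta, 0 < eta -> \forall n \near \oo%classic, 1 - eta <= P n.
Proof.
move=> P1; rewrite /whp; split=> [/cvgrPdist_le PP eta /PP|PP].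
  by apply: filterS => n; rewrite ger0_norm ?subr_ge0 // lerBlDr addrC -lerBlDr.
apply/cvgrPdist_le => eta /PP; apply: filterS => n.
by rewrite ger0_norm ?subr_ge0 // => ?; rewrite lerBlDr addrC -lerBlDr.
Qed.

Unset Implicit Arguments.

Theorem theorem3p3 (R : realType) (alpha : R) (Delta : nat) (p : nat -> R)
    (Galpha : forall n, sgraph 'I_n)
    (V : nat -> finType) (F : forall n, sgraph (V n))
    (FF : forall n, {set {set V n}})
    (alpha_gt0 : 0 < alpha)
    (p01 : forall n, 0 <= p n <= 1)
    (cardV : forall n, #|V n| = n)
    (Galpha_mindeg :
       \forall n \near \oo%classic, min_degree_ge (Galpha n) (alpha * n%:R))
    (F_maxdeg : \forall n \near \oo%classic, max_degree (F n) = Delta)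
    (F_suitable : suitable alpha Delta p F FF) :
  whp (fun n => gnp_prob (p n)
    [pred g : sgraph 'I_n | contains_copy (F n) (graph_union (Galpha n) g)]).
Proof.
have p201 n : 0 <= p n / 2 <= 1 by have /andP[? ?] := p01 n; apply/andP; split; lra.
have p601 n : 0 <= p n / 6 <= 1 by have /andP[? ?] := p01 n; apply/andP; split; lra.
apply/whp_leP => [n|e e0]; first exact: gnp_prob_le1.
(* For [Delta = 0] the graph has no edges and any bijection is a copy; the scattered set needs a
   positive degree. *)
have [D0|D0] := posnP Delta.
  move: F_maxdeg; apply: filterS => n Fn.
  apply: (@le_trans _ _ 1); first by lra.
  rewrite -(gnp_probT n (p n)); apply: ler_gnp_prob => // g _.
  by apply: contains_copy_max_degree0; rewrite ?cardV ?card_ord // Fn.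
have [FFsize A1 A2] := F_suitable.
have {}A1 := (whp_leP (fun n => gnp_prob_le1 _ (p201 n))).1 A1.
(* Three factors [1 - eta] are lost, to (A1), to the relabelling and to (A2); the cap at 1 keeps
   them nonnegative. *)
pose eta : R := Num.min (e / 3) 1.
have eta0 : 0 < eta by rewrite lt_min ltr01 andbT divr_gt0.
have eta1 : eta <= 1 by rewrite ge_min lexx orbT.
have eta_e : 3 * eta <= e.
  have : eta <= e / 3 by rewrite ge_min lexx.
  lra.
pose k := Delta.+1; pose eps := suitable_eps alpha Delta.
have k0 : 0 < k%:R :> R by rewrite ltr0n.
(* Chunks of about [c * n] blocks reveal at most alpha n / 32 points, so each target keeps density
   [beta]; they are also small compared with [I], whose size is of order n / Delta^2. *)
pose c := alpha / (32 * k%:R ^+ 2).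
have c0 : 0 < c by rewrite divr_gt0 // mulr_gt0 // exprn_gt0.
pose beta := 31 / 32 * alpha.
have beta0 : 0 < beta by rewrite /beta; lra.
pose b := beta ^+ k.
have b0 : 0 < b by rewrite exprn_gt0.
have gamma0 : 0 < b * c / 80 by rewrite divr_gt0 // mulr_gt0.
apply: filter_app (A2 eta eta0); near=> n => A2n.
have n0 : (0 < n)%N by near: n; exact: nbhs_infty_gt.
have degGa : min_degree_ge (Galpha n) (alpha * n%:R) by near: n.
have Fn : max_degree (F n) = Delta by near: n.
have FFn S : S \in FF n -> (1 - eps) * n%:R <= #|S|%:R.
  by move: S; near: n; exact: FFsize.
have A1n : 1 - eta <= gnp_prob (p n / 2) [pred g : sgraph 'I_n |
    [exists S in FF n, contains_copy (induced_subgraph (F n) S) g]].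
  by near: n; apply: A1.
have cn : 1 <= c * n%:R.
  rewrite -ler_pdivrMl // mulr1; near: n; exact: nbhs_infty_ger.
(* The factor [expR (b / 80)] pays for rounding [c * n] down to [m]. *)
have tail : n%:R ^+ 3 * (expR (b / 80) * expR (- (b * c / 80 * n%:R))) <= eta.
  by near: n; apply: cube_mul_expRN.
(* A vertex has at most [n] neighbours, so the degree condition itself bounds [alpha]. *)
have alpha1 : alpha <= 1.
  have n0R : 0 < n%:R :> R by rewrite ltr0n.
  rewrite -(ler_pM2r n0R) mul1r; apply: le_trans (degGa (Ordinal n0)) _.
  by rewrite ler_nat -[leqRHS]card_ord max_card.
pose m := Num.truncn (c * n%:R).
have /andP[mc cm] : m%:R <= c * n%:R < m.+1%:R by apply: truncn_itv; lra.
have m0 : (0 < m)%N by rewrite -ltnS -(ltr_nat R) (le_lt_trans cn).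
have km : 32 * (k%:R ^+ 2 * m%:R) <= alpha * n%:R.
  have -> : alpha * n%:R = 32 * (k%:R ^+ 2 * (c * n%:R)) by rewrite /c; field; rewrite gt_eqF.
  by rewrite !ler_wpM2l // exprn_ge0 // ltW.
have betam : beta * n%:R <= alpha * n%:R - (k * m)%:R.
  have : (k * m)%:R <= k%:R ^+ 2 * m%:R :> R.
    by rewrite natrM expr2 ler_wpM2r // -natrM ler_nat leq_pmulr.
  rewrite /beta; lra.
have beta01 : 0 <= beta <= 1 by apply/andP; split; rewrite /beta; lra.
pose kappa := 4 * eps * n%:R.
pose good (g : sgraph 'I_n) := `[< good_embedding (F n) (FF n) (Galpha n) kappa g >].
have many_good : (1 - eta) * (1 - eta) <= gnp_prob (p n / 2) good.
  apply: le_trans (ler_wpM2l _ A1n) _; first by lra.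
  apply: gnp_prob_average => // g /exists_inP[S SFF Sg].
  apply: le_trans (card_good_relabelings (cardV n) SFF Sg beta01 D0 Fn degGa betam m0 _).
    rewrite ler_wpM2r // lerB // (le_trans _ tail) // ler_wpM2l ?exprn_ge0 //.
    rewrite -expRD ler_expR -/k -/b.
    have : b * (c * n%:R) <= b * (m%:R + 1) by apply: ler_wpM2l; rewrite ?natr1 ltW.
    lra.
  move=> I cardI.
  apply: (@suitable_eps_bound R alpha n%:R #|I|%:R m%:R _ Delta) => //.
  - by rewrite alpha_gt0.
  - have SC : #|~: S|%:R <= eps * n%:R.
      have := FFn S SFF; have : #|S|%:R + #|~: S|%:R = n%:R :> R.
        by rewrite -natrD cardsC cardV.
      lra.
    have := cardI; rewrite cardV -(ler_nat R) natrD natrM -/k -/eps.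
    have := ler_wpM2l (ltW k0) SC; lra.
  - have : #|I|%:R <= (#|I| %/ m * m)%:R + m%:R :> R.
      by rewrite -natrD ler_nat {1}(divn_eq #|I| m) leq_add2l ltnW // ltn_mod.
    lra.
have sprinkle := @gnp_sprinkle R n (p n) (p01 n) eta
  [pred g | contains_copy (F n) (graph_union (Galpha n) g)] good.
have {}sprinkle : (1 - eta) * gnp_prob (p n / 2) good <= gnp_prob (p n)
    [pred g : sgraph 'I_n | contains_copy (F n) (graph_union (Galpha n) g)].
  apply: sprinkle => [g h gh|g /asboolP].
    by apply: contains_copyS; apply: setUS.
  move=> [S [I [phi [SFF phi_inj [IS I_in I_indep] phi_copy flex]]]].
  have ext := switch_extension phi_inj IS I_in I_indep phi_copy.
  apply: le_trans (ler_gnp_prob (p601 n) (ext (Galpha n))).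
  (* (A2) is applied to the copy of F[S] on the lower clones, with hosts among the upper clones;
     [switch_extension] brings the resulting copy of F back to [n]. *)
  apply: (A2n S (clone_graph (Galpha n) g) (lo_copy S phi) (host (F n) I phi (Galpha n))) => //.
    exact: lo_copyP phi_inj phi_copy.
  move=> v vS; split=> [|w].
    exact: host_disjoint.
  apply: le_trans (flex (phi v) (base w)) _.
  by rewrite ler_nat; apply: card_host.
apply: le_trans sprinkle.
have : (1 - eta) * ((1 - eta) * (1 - eta)) <= (1 - eta) * gnp_prob (p n / 2) good.
  by rewrite ler_wpM2l //; lra.
have : 1 - 3 * eta <= (1 - eta) * ((1 - eta) * (1 - eta)).
  have -> : (1 - eta) * ((1 - eta) * (1 - eta)) =
      1 - 3 * eta + eta ^+ 2 * (3 - eta) by ring.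
  by rewrite lerDl mulr_ge0 ?sqr_ge0 //; lra.
lra.
Unshelve. all: by end_near.
Qed.
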